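(* Let $G=G_1+\dots+G_k$ and $H=H_1+\dots+H_l$ be two graphs written as sums (disjoint unions) of their connected components. Then $G$ and $H$ are quantum isomorphic if and only if $k=l$ and there exists a permutation $\sigma\in S_k$ such that for all $1\le i\le k$ the graph $G_i$ is quantum isomorphic to $H_{\sigma(i)}$.
   Context: Graphs are finite, simple and undirected, with at least one vertex; $+$ denotes disjoint union. Unital $C^*$-algebras are assumed nonzero. A magic unitary with coefficients in a unital $C^*$-algebra $X$ is a square matrix with entries in $X$ that are self-adjoint projections such that each row and each column sums to $1_X$. Two graphs $G$ and $H$ with the same number of vertices are quantum isomorphic if there exist a unital $C^*$-algebra $X$ and a magic unitary $U$ with coefficients in $X$, rows indexed by $V(H)$ and columns by $V(G)$, such that $U\,\mathrm{Adj}(G)=\mathrm{Adj}(H)\,U$, where $\mathrm{Adj}$ denotes the adjacency matrix. *)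

(* Defs.v *)
From HB Require Import structures.
From mathcomp Require Import all_boot all_order all_algebra all_fingroup.
From mathcomp Require Import complex.
From mathcomp Require Import all_classical all_reals all_analysis.

Set Implicit Arguments.
Unset Strict Implicit.
Unset Printing Implicit Defensive.

Import Order.TTheory GRing.Theory Num.Theory.
Local Open Scope ring_scope.

(* Nonzero unital complex C*-algebras: an algType has a unit and is nonzero.
   The norm is a field of the structure, with values in R, because MathComp
   cannot join its normed modules with its rings: their only common
   refinement is numDomainType, which is commutative. *)
HB.mixin Record Algebra_isCStar (R : realType) A of GRing.Algebra R[i] A := {
  star : A -> A ;
  cnorm : A -> R ;
  starK : involutive star ;
  starD : {morph star : x y / x + y} ;
  starZ : forall (a : R[i]) (x : A), star (a *: x) = a^* *: star x ;
  starM : forall x y : A, star (x * y) = star y * star x ;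
  cnorm_ge0 : forall x : A, 0 <= cnorm x ;
  cnorm_eq0 : forall x : A, cnorm x = 0 -> x = 0 ;
  cnormD_le : forall x y : A, cnorm (x + y) <= cnorm x + cnorm y ;
  cnormZ : forall (a : R[i]) (x : A), cnorm (a *: x) = Normc.normc a * cnorm x ;
  cnormM_le : forall x y : A, cnorm (x * y) <= cnorm x * cnorm y ;
  cnorm_starM : forall x : A, cnorm (star x * x) = cnorm x ^+ 2 ;
  cnorm_complete : forall u : nat -> A,
    (forall e : R, 0 < e -> exists N : nat, forall m n : nat,
       (N <= m)%N -> (N <= n)%N -> cnorm (u m - u n) < e) ->
    exists x : A, forall e : R, 0 < e -> exists N : nat, forall n : nat,
      (N <= n)%N -> cnorm (u n - x) < e
}.

#[short(type="cstarAlgType")]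
HB.structure Definition CStarAlgebra (R : realType) :=
  { A of GRing.Algebra R[i] A & Algebra_isCStar R A }.

Record graph := Graph {
  vertex :> finType ;
  adj : rel vertex ;
  adj_sym : symmetric adj ;
  adj_irr : irreflexive adj ;
  vertex_gt0 : (0 < #|vertex|)%N
}.

Definition connected_graph (G : graph) : Prop :=
  forall x y : G, connect (@adj G) x y.

Definition sum_adj (k : nat) (Gs : 'I_k -> graph) : rel {i : 'I_k & Gs i} :=
  fun u v => (tag u == tag v) && adj (tagged u) (tagged_as u v).

(* G = Gs 0 + ... + Gs (k - 1), up to isomorphism of graphs *)
Definition is_graph_sum (G : graph) (k : nat) (Gs : 'I_k -> graph) : Prop :=
  exists2 f : {i : 'I_k & Gs i} -> G,
    bijective f & forall u v, adj (f u) (f v) = sum_adj u v.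

Section QuantumIsomorphism.
Variable R : realType.

Definition is_projection (X : cstarAlgType R) (p : X) : Prop :=
  star p = p /\ p * p = p.

(* Squareness is the condition m = n: keeping two dimensions lets the rows and
   the columns be indexed by the vertices of two different graphs. *)
Definition magic_unitary (X : cstarAlgType R) (m n : nat)
    (U : 'M[X]_(m, n)) : Prop :=
  [/\ m = n,
      forall i j, is_projection (U i j),
      forall i, \sum_j U i j = 1
    & forall j, \sum_i U i j = 1].

Definition adj_mx (X : cstarAlgType R) (G : graph) : 'M[X]_#|G| :=
  \matrix_(i, j) (adj (enum_val i) (enum_val j))%:R.

End QuantumIsomorphism.

Definition quantum_isomorphic (R : realType) (G H : graph) : Prop :=
  #|G| = #|H| /\
  exists (X : cstarAlgType R) (U : 'M[X]_(#|H|, #|G|)),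
    magic_unitary U /\ U *m adj_mx X G = adj_mx X H *m U.

(* Main.v *)
From HB Require Import structures.
Require Import Defs.
From mathcomp Require Import all_boot all_order all_algebra all_fingroup.
From mathcomp Require Import complex ring lra zify.
From mathcomp Require Import all_classical all_reals all_analysis.
From mathcomp Require generic_quotient.

(* A magic unitary U intertwining the adjacency matrices satisfies
   u_ax u_by = 0 when a, b are adjacent and x, y are not.  Hence the sum of the
   entries of row a over the component G_i depends only on the component H_j
   of a; comparing with the column sums of the same block, these sums form a
   magic unitary (p_ji), so k = l.  A state turns it into a doubly stochastic
   matrix and Hall's theorem gives a permutation s with p_{s(i) i} <> 0; the
   block (s(i), i) is then a quantum isomorphism over the corner p X p.

   Conversely the blocks G_i -> H_{s(i)} live over different algebras X_i, and
   are put on the diagonal of one matrix over a C*-algebra receiving unital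
   *-homomorphisms from all the X_i.  For two algebras A and B this is the GNS
   completion, for a product of states, of the finitely supported measures on
   the multiplicative monoid A x B; it need only be real linear in each factor,
   so real-valued states suffice.  States come from Hahn-Banach and from the
   positivity of x* x. *)

Set Implicit Arguments.
Unset Strict Implicit.
Unset Printing Implicit Defensive.

Import Order.TTheory GRing.Theory Num.Theory.
Local Open Scope ring_scope.
Local Open Scope complex_scope.

(** * Square roots in a C*-algebra *)

Section CStarBasics.
Variables (R : realType) (X : cstarAlgType R).
Implicit Types (a b h k x y : X) (r t : R).

(** Positivity enters three times: in the orthogonality of projections that sum to [1], in the
    existence of states, and in writing [cnorm a ^+ 2 - star a * a] as a square, which bounds left
    multiplication. Spectral theory is avoided: all three rest on one analytic input, the square
    root of an element near [1] obtained by iteration, together with the inequality |k|^2 <= |h^2 +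
    k^2| for commuting self-adjoint h and k.

    The converse needs a common algebra because the rows of the assembled matrix must sum to [1].
    The direct product of the X_i does not serve: a unital map from X_i into it would give one from
    X_i to every X_j. A tensor product removes this obstacle. No Hilbert space is built for it: the
    completed norm is the operator norm of left multiplication, read off from the GNS form, and the
    product of two states is positive by Schur's product theorem.

    In the direct implication the state turns the noncommutative matrix of the p_ji into numbers,
    and a positive number certifies a nonzero projection. *)

Lemma conj_realC r : ((r%:C)^*)%R = r%:C.
Proof. by apply: conjc_real. Qed.

Lemma normc_realC r : Normc.normc (r%:C) = `|r|.
Proof. by rewrite /= expr0n addr0 sqrtr_sqr. Qed.

Lemma starB x y : star (x - y) = star x - star y.
Proof. by rewrite starD -scaleN1r starZ rmorphN1 scaleN1r. Qed.

Lemma starN x : star (- x) = - star x.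
Proof. by rewrite -scaleN1r starZ rmorphN1 scaleN1r. Qed.

Lemma star0 : star (0 : X) = 0.
Proof. by rewrite -[0 in LHS](subrr 0) starB subrr. Qed.

Lemma star1 : star (1 : X) = 1.
Proof. by rewrite -[LHS]mulr1 -[X in _ * X]starK -starM mulr1 starK. Qed.

Lemma star_sum (I : Type) (s : seq I) (P : pred I) (F : I -> X) :
  star (\sum_(i <- s | P i) F i) = \sum_(i <- s | P i) star (F i).
Proof. by apply: (big_morph _ (@starD _ _)); exact: star0. Qed.

Lemma starZr r x : star (r%:C *: x) = r%:C *: star x.
Proof. by rewrite starZ conj_realC. Qed.

Lemma cnormZr r x : cnorm (r%:C *: x) = `|r| * cnorm x.
Proof. by rewrite cnormZ normc_realC. Qed.

Lemma cnorm0 : cnorm (0 : X) = 0.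
Proof. by rewrite -(scale0r 0) cnormZ Normc.normc0 mul0r. Qed.

Lemma cnormN x : cnorm (- x) = cnorm x.
Proof. by rewrite -scaleN1r cnormZ normcN Normc.normc1 mul1r. Qed.

Lemma cnorm_sub_le x y z : cnorm (x - z) <= cnorm (x - y) + cnorm (y - z).
Proof. by rewrite -[x - z](subrKA y); apply: cnormD_le. Qed.

Lemma cnorm_subC x y : cnorm (x - y) = cnorm (y - x).
Proof. by rewrite -opprB cnormN. Qed.

Lemma cnormB_le x y : cnorm (x - y) <= cnorm x + cnorm y.
Proof. by rewrite -(cnormN y); apply: cnormD_le. Qed.

Lemma cnorm_star x : cnorm (star x) = cnorm x.
Proof.
suff le y : cnorm y <= cnorm (star y).
  by apply/eqP; rewrite eq_le le andbT -{2}[x]starK le.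
have := cnorm_ge0 y; rewrite le_eqVlt => /predU1P [<-|y0]; first exact: cnorm_ge0.
by rewrite -(ler_pM2r y0) -expr2 -cnorm_starM cnormM_le.
Qed.

Lemma cnorm1 : cnorm (1 : X) = 1.
Proof.
have n0 : cnorm (1 : X) != 0.
  by apply/eqP => /cnorm_eq0 /eqP; rewrite oner_eq0.
apply: (mulfI n0); rewrite mulr1 -expr2 -cnorm_starM.
by rewrite star1 mulr1.
Qed.

Lemma cnorm_alg r : cnorm (r%:C *: (1 : X)) = `|r|.
Proof. by rewrite cnormZr cnorm1 mulr1. Qed.

Lemma cnorm_sqr h : star h = h -> cnorm (h * h) = cnorm h ^+ 2.
Proof. by move=> hs; rewrite -cnorm_starM hs. Qed.

Lemma star_mul_eq0 x : star x * x = 0 -> x = 0.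
Proof.
move=> x0; apply: cnorm_eq0; apply/eqP; rewrite -sqrf_eq0 -cnorm_starM x0.
by rewrite cnorm0.
Qed.

Lemma selfadj_sqr_eq0 h : star h = h -> h * h = 0 -> h = 0.
Proof. by move=> hs h0; apply: star_mul_eq0; rewrite hs. Qed.

Lemma limit_uniq (u : nat -> X) x y :
  (forall e, 0 < e -> exists N, forall n, (N <= n)%N -> cnorm (u n - x) < e) ->
  (forall e, 0 < e -> exists N, forall n, (N <= n)%N -> cnorm (u n - y) < e) ->
  x = y.
Proof.
move=> ux uy; apply/eqP; rewrite -subr_eq0; apply/eqP/cnorm_eq0/eqP.
rewrite eq_le cnorm_ge0 andbT; apply/ler_addgt0Pl => e e0; rewrite addr0.
have e2 : 0 < e / 2 by rewrite divr_gt0.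
have [[M hM] [N hN]] := (ux _ e2, uy _ e2).
have := cnorm_sub_le x (u (maxn M N)) y; move=> /le_trans; apply.
rewrite [e in leRHS](splitr e) lerD // ltW //; last by rewrite hN // leq_maxr.
by rewrite cnorm_subC hM // leq_maxl.
Qed.

(* The iterates of t |-> (1 + t^2) / 2 dominate those of y |-> (x + y^2) / 2
   when |x| <= 1. *)
Fixpoint sqrt_iter_norm (n : nat) : R :=
  if n is m.+1 then (1 + sqrt_iter_norm m ^+ 2) / 2 else 0.

Fixpoint sqrt_iter (x : X) (n : nat) : X :=
  if n is m.+1 then (2^-1 : R)%:C *: (x + sqrt_iter x m * sqrt_iter x m) else 0.

Lemma sqrt_iter_norm_bound n : 0 <= sqrt_iter_norm n <= 1.
Proof.
elim: n => [|n /andP [h0 h1]] /=; first by rewrite lexx ler01.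
apply/andP; split; nra.
Qed.

(** The increment at [t] is [(1 - t)^2 / 2 >= 0], so the sequence is monotone and bounded by [1]; a
    term close to the supremum supplies [N]. *)
Lemma sqrt_iter_norm_cauchy (e : R) : 0 < e -> exists N, forall m n,
  (N <= m)%N -> (m <= n)%N -> sqrt_iter_norm n - sqrt_iter_norm m < e.
Proof.
move=> e0.
have incr n : sqrt_iter_norm n <= sqrt_iter_norm n.+1.
  by rewrite /=; have := sqr_ge0 (1 - sqrt_iter_norm n); rewrite !expr2; lra.
have mono m n : (m <= n)%N -> sqrt_iter_norm m <= sqrt_iter_norm n.
  elim: n => [|n IH]; first by rewrite leqn0 => /eqP ->.
  rewrite leq_eqVlt => /predU1P [->//|]; rewrite ltnS => /IH /le_trans; exact.
set S := [set sqrt_iter_norm n | n in [set: nat]]%classic.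
have supS : has_sup S.
  split; first by exists (sqrt_iter_norm 0), 0%N.
  by exists 1 => _ [n _ <-]; have /andP [] := sqrt_iter_norm_bound n.
have [_ [N _ <-] hN] := sup_adherent e0 supS.
exists N => m n Nm mn.
have : sqrt_iter_norm n <= sup S by apply: ub_le_sup; [case: supS | exists n].
have := mono _ _ Nm; move: hN; lra.
Qed.

Lemma sqrt_iter_norm_le x n : cnorm x <= 1 ->
  cnorm (sqrt_iter x n) <= sqrt_iter_norm n.
Proof.
move=> x1; elim: n => [|n IH] /=; first by rewrite cnorm0.
rewrite cnormZr ger0_norm ?invr_ge0 // mulrC ler_wpM2r ?invr_ge0 //.
rewrite (le_trans (cnormD_le _ _)) // lerD // (le_trans (cnormM_le _ _)) //.
by rewrite expr2 ler_pM // cnorm_ge0.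
Qed.

Lemma sqrt_iter_comm x b n : b * x = x * b ->
  b * sqrt_iter x n = sqrt_iter x n * b.
Proof.
move=> bx; elim: n => [|n IH] /=; first by rewrite mulr0 mul0r.
by rewrite -scalerAr -scalerAl mulrDr mulrDl bx mulrA IH -!mulrA IH.
Qed.

Lemma sqrt_iter_star x n : star x = x -> star (sqrt_iter x n) = sqrt_iter x n.
Proof.
move=> xs; elim: n => [|n IH] /=; first exact: star0.
by rewrite starZr starD starM IH xs.
Qed.

(** Consecutive iterates commute, so the next increment factors as [(y + z) * (y - z)] up to [1/2].
    The majorants obey the same recursion, which carries the bound one step further. *)
Lemma sqrt_iter_step x n : cnorm x <= 1 ->
  cnorm (sqrt_iter x n.+1 - sqrt_iter x n)
    <= sqrt_iter_norm n.+1 - sqrt_iter_norm n.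
Proof.
move=> x1; elim: n => [|n IH].
  rewrite /= !subr0 mulr0 expr0n addr0 addr0 cnormZr ger0_norm ?invr_ge0 //.
  by rewrite mulrC ler_wpM2r // invr_ge0.
set y := sqrt_iter x n.+1 in IH *; set z := sqrt_iter x n in IH *.
set s := sqrt_iter_norm n.+1 in IH *; set t := sqrt_iter_norm n in IH *.
have yz : y * z = z * y.
  by apply: sqrt_iter_comm; symmetry; apply: sqrt_iter_comm.
have -> : sqrt_iter x n.+2 - y = (2^-1 : R)%:C *: ((y + z) * (y - z)).
  have -> : sqrt_iter x n.+2 - y =
      (2^-1 : R)%:C *: (x + y * y) - (2^-1 : R)%:C *: (x + z * z) by [].
  by rewrite -scalerBr mulrDl !mulrBr yz subrKA opprD addrACA subrr add0r.
have -> : sqrt_iter_norm n.+2 - s = 2^-1 * ((s + t) * (s - t)).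
  have -> : sqrt_iter_norm n.+2 = (1 + s ^+ 2) / 2 by [].
  have -> : s = (1 + t ^+ 2) / 2 by [].
  by field.
rewrite cnormZr ger0_norm ?invr_ge0 // ler_wpM2l ?invr_ge0 //.
rewrite (le_trans (cnormM_le _ _)) // ler_pM ?cnorm_ge0 //.
by rewrite (le_trans (cnormD_le _ _)) // lerD // sqrt_iter_norm_le.
Qed.

Lemma sqrt_iter_dist x m n : cnorm x <= 1 -> (m <= n)%N ->
  cnorm (sqrt_iter x n - sqrt_iter x m) <= sqrt_iter_norm n - sqrt_iter_norm m.
Proof.
move=> x1; elim: n => [|n IH]; first by rewrite leqn0 => /eqP ->; rewrite !subrr cnorm0.
rewrite leq_eqVlt => /predU1P [->|]; first by rewrite !subrr cnorm0.
rewrite ltnS => /IH le.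
apply: (le_trans (cnorm_sub_le _ (sqrt_iter x n) _)).
by rewrite -[leRHS](subrKA (sqrt_iter_norm n)) lerD // sqrt_iter_step.
Qed.

Lemma mul_cvg (u v : nat -> X) x y M : 
  (forall n, cnorm (v n) <= M) -> 
  (forall e, 0 < e -> exists N, forall n, (N <= n)%N -> cnorm (u n - x) < e) ->
  (forall e, 0 < e -> exists N, forall n, (N <= n)%N -> cnorm (v n - y) < e) ->
  forall e, 0 < e -> exists N, forall n, (N <= n)%N ->
    cnorm (u n * v n - x * y) < e.
Proof.
move=> vM ux vy e e0.
have M0 : 0 <= M by apply: le_trans (vM 0%N); apply: cnorm_ge0.
have x0 := cnorm_ge0 x.
have d0 : 0 < e / (M + cnorm x + 1) by rewrite divr_gt0 //; lra.
have [[N1 h1] [N2 h2]] := (ux _ d0, vy _ d0).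
exists (maxn N1 N2) => n; rewrite geq_max => /andP [/h1 l1 /h2 l2].
have -> : u n * v n - x * y = (u n - x) * v n + x * (v n - y).
  by rewrite mulrBl mulrBr addrA subrK.
apply: (le_lt_trans (cnormD_le _ _)).
have : e / (M + cnorm x + 1) * (M + cnorm x + 1) = e.
  by rewrite divfK //; apply/eqP; lra.
move: (e / _) d0 l1 l2 => d d0 l1 l2 de.
have := cnormM_le (u n - x) (v n); have := cnormM_le x (v n - y).
have := cnorm_ge0 (u n - x); have := cnorm_ge0 (v n - y).
have := cnorm_ge0 (v n); have := vM n.
nra.
Qed.

(** With [x = 1 - a], the limit [y] of the iteration satisfies [y = (x + y^2) / 2], that is
    [(1 - y)^2 = a], and [s] is [1 - y]. The iterates are polynomials in [x], so whatever commutes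
    with [a] commutes with the limit; this last clause stands in for functional calculus below. *)
Lemma sqrt_near1 a : star a = a -> cnorm (1 - a) <= 1 ->
  exists s, [/\ star s = s, s * s = a, cnorm (1 - s) <= 1
    & forall b, b * a = a * b -> b * s = s * b].
Proof.
move=> sa n1; set x := 1 - a.
have sx : star x = x by rewrite starB star1 sa.
have cau : forall e, 0 < e -> exists N, forall m n, (N <= m)%N -> (N <= n)%N ->
    cnorm (sqrt_iter x m - sqrt_iter x n) < e.
  move=> e /sqrt_iter_norm_cauchy [N hN]; exists N => m n Nm Nn.
  case: (leqP m n) => mn.
    by rewrite cnorm_subC; apply: le_lt_trans (sqrt_iter_dist _ mn) (hN _ _ Nm mn).
  by apply: le_lt_trans (sqrt_iter_dist _ (ltnW mn)) (hN _ _ Nn (ltnW mn)).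
have [y ylim] := cnorm_complete (sqrt_iter x) cau.
have cst (z : X) : forall e, 0 < e -> exists N : nat, forall n : nat, (N <= n)%N ->
    cnorm (z - z) < e.
  by move=> e e0; exists 0%N => n _; rewrite subrr cnorm0.
have bnd n : cnorm (sqrt_iter x n) <= 1.
  apply: le_trans (sqrt_iter_norm_le n n1) _.
  by have /andP [] := sqrt_iter_norm_bound n.
have comm b : b * x = x * b -> b * y = y * b.
  move=> bx; apply: (@limit_uniq (fun n => b * sqrt_iter x n)).
    exact: mul_cvg bnd (cst b) ylim.
  move=> e e0.
  have [N hN] := @mul_cvg _ (fun=> b) _ _ (cnorm b) (fun=> lexx _) ylim (cst b) _ e0.
  by exists N => n Nn; rewrite sqrt_iter_comm // hN.
have sy : star y = y.
  apply: (@limit_uniq (sqrt_iter x)) => // e /ylim [N hN]; exists N => n Nn.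
  by rewrite -(sqrt_iter_star n sx) -starB cnorm_star hN.
have y1 : cnorm y <= 1.
  apply/ler_addgt0Pl => e /ylim [N /(_ N (leqnn N)) hN].
  have := cnormD_le (y - sqrt_iter x N) (sqrt_iter x N); rewrite subrK.
  move/le_trans; apply; rewrite lerD //.
  by rewrite cnorm_subC ltW.
have yE : y = (2^-1 : R)%:C *: (x + y * y).
  apply: (@limit_uniq (fun n => sqrt_iter x n.+1)) => e e0.
    by have [N hN] := ylim _ e0; exists N => n Nn; apply: hN; apply: leqW.
  have [N hN] := mul_cvg bnd ylim ylim e0; exists N => n Nn /=.
  rewrite -scalerBr opprD addrACA subrr add0r.
  rewrite cnormZr ger0_norm ?invr_ge0 //.
  have := hN _ Nn; have := cnorm_ge0 (sqrt_iter x n * sqrt_iter x n - y * y); lra.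
exists (1 - y); split.
- by rewrite starB star1 sy.
- have : y + y = x + y * y.
    rewrite {1 2}yE -scalerDl -rmorphD /= (_ : 2^-1 + 2^-1 = 1 :> R) ?scale1r //.
    lra.
  rewrite mulrBl mul1r mulrBr mulr1 => e2.
  have -> : 1 - y - (y - y * y) = 1 - ((y + y) - y * y).
    by rewrite -[in LHS]addrA -opprD addrA.
  by rewrite e2 addrK /x subKr.
- by rewrite opprB addrC subrK.
move=> b ba; rewrite mulrBr mulrBl mulr1 mul1r comm //.
by rewrite /x mulrBr mulrBl mulr1 mul1r ba.
Qed.

End CStarBasics.

(** * The positive cone *)

Section Positive.
Variables (R : realType) (X : cstarAlgType R).
Implicit Types (a b h k x y : X) (r t : R).

Lemma mulii : 'i * 'i = -1 :> R[i].
Proof. by rewrite -expr2 sqr_i. Qed.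

Lemma conj_i : (('i : R[i])^*)%R = - 'i.
Proof. by apply/eqP; rewrite eq_complex /= oppr0 !eqxx. Qed.

Lemma scale_half x : 2^-1%:C *: (x + x) = x.
Proof.
by rewrite scalerDr -scalerDl -rmorphD /= (_ : 2^-1 + 2^-1 = 1 :> R) ?scale1r //; lra.
Qed.

(** Norm form of the statement that the spectrum of [h] lies between [0] and [2 t]. It is visibly
    stable under sums, and it fits functionals with [f 1 = 1] and [f x <= cnorm x]. *)
Definition cpos h := star h = h /\ exists t : R, cnorm (t%:C *: 1 - h) <= t.

Lemma cposD h k : cpos h -> cpos k -> cpos (h + k).
Proof.
move=> [hs [t ht]] [ks [u ku]]; split; first by rewrite starD hs ks.
exists (t + u); rewrite rmorphD /= scalerDl opprD addrACA.
by rewrite (le_trans (cnormD_le _ _)) // lerD.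
Qed.

Lemma cposZ r h : 0 <= r -> cpos h -> cpos (r%:C *: h).
Proof.
move=> r0 [hs [t ht]]; split; first by rewrite starZr hs.
exists (r * t); rewrite rmorphM /= -scalerA -scalerBr cnormZr ger0_norm //.
by rewrite ler_wpM2l.
Qed.

Lemma cpos0 : cpos 0.
Proof. by split; [exact: star0 | exists 0; rewrite scale0r subrr cnorm0]. Qed.

Lemma star_mul_cartesian h k : star h = h -> star k = k -> h * k = k * h ->
  star (h + 'i *: k) * (h + 'i *: k) = h * h + k * k.
Proof.
move=> hs ks hk; rewrite starD starZ hs ks.
rewrite conj_i.
rewrite scaleNr mulrDr !mulrBl -!scalerAr -!scalerAl hk scalerA mulii.
by rewrite scaleN1r opprK subrKA.
Qed.

(** [k] is the imaginary part of the normal element [u = h + 'i *: k], so [2 * cnorm k <= cnorm u +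
    cnorm (star u) = 2 * cnorm u], and [cnorm u ^+ 2] is the right-hand side. *)
Lemma cnorm_cartesian_le h k : star h = h -> star k = k -> h * k = k * h ->
  cnorm k ^+ 2 <= cnorm (h * h + k * k).
Proof.
move=> hs ks hk; rewrite -(star_mul_cartesian hs ks hk) cnorm_starM.
rewrite lerXn2r ?nnegrE ?cnorm_ge0 //.
set u := h + 'i *: k.
have su : cnorm (star u) = cnorm u by apply: cnorm_star.
have : u - star u = (2 : R)%:C *: ('i *: k).
  rewrite /u starD starZ hs ks.
  rewrite conj_i.
  rewrite scaleNr opprB addrC addrA subrK -scalerDl scalerA; congr (_ *: _).
  by rewrite (rmorph_nat (real_complex R) 2) mulr_natl mulr2n.
move/(congr1 (@cnorm R X)); rewrite cnormZr cnormZ /= expr0n add0r expr1n sqrtr1.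
rewrite mul1r ger0_norm // => e; have := cnormB_le u (star u).
rewrite e su; lra.
Qed.

(** The root [s] of [1 - k * k] commutes with [k], and [k * k + s * s = 1]; the previous inequality
    then bounds [s], hence its square, by [1]. *)
Lemma cnorm_1_sub_sqr k : star k = k -> cnorm k <= 1 -> cnorm (1 - k * k) <= 1.
Proof.
move=> ks k1; have [||s [ss sE _ comm]] := @sqrt_near1 R X (1 - k * k).
- by rewrite starB star1 starM ks.
- by rewrite subKr (le_trans (cnormM_le _ _)) // mulr_ile1 ?cnorm_ge0.
have ks' : k * s = s * k.
  by apply: comm; rewrite mulrBr mulrBl mulr1 mul1r mulrA.
have := cnorm_cartesian_le ks ss ks'.
by rewrite sE addrC subrK cnorm1 -sE cnorm_sqr.
Qed.

Lemma cpos_sqr k : star k = k -> cpos (k * k).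
Proof.
move=> ks; split; first by rewrite starM ks.
have [k0|k0] := eqVneq (cnorm k) 0.
  by exists 0; rewrite (cnorm_eq0 _ k0) mulr0 scale0r subrr cnorm0.
have kp : 0 < cnorm k by rewrite lt_def k0 cnorm_ge0.
pose l := (cnorm k)^-1%:C *: k.
have kE : k = (cnorm k)%:C *: l by rewrite /l scalerA -rmorphM /= divff // scale1r.
have ls : star l = l by rewrite starZr ks.
have l1 : cnorm l <= 1 by rewrite cnormZr ger0_norm ?invr_ge0 ?cnorm_ge0 // mulVf.
exists (cnorm k ^+ 2).
rewrite {2 3}kE -scalerAl -scalerAr scalerA -rmorphM -expr2 -scalerBr cnormZr.
rewrite ger0_norm ?sqr_ge0 // -[leRHS]mulr1 ler_wpM2l ?sqr_ge0 //.
exact: cnorm_1_sub_sqr.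
Qed.

(** Dividing by the witness [t] brings [h] within distance [1] of the unit, where [sqrt_near1]
    applies; its norm clause is also the positivity of the root. *)
Lemma cpos_sqrt h : cpos h -> exists s,
  [/\ cpos s, s * s = h & forall b, b * h = h * b -> b * s = s * b].
Proof.
case=> hs [t ht]; have t0 : 0 <= t by apply: le_trans (cnorm_ge0 _) ht.
have [t00|tn0] := eqVneq t 0.
  exists 0; have -> : h = 0.
    apply: cnorm_eq0; apply/eqP; rewrite eq_le cnorm_ge0 andbT.
    by move: ht; rewrite t00 scale0r sub0r cnormN.
  by split=> [||b]; rewrite ?mulr0 ?mul0r //; exact: cpos0.
have tp : 0 < t by rewrite lt_def tn0.
have [||s [ss sE s1 comm]] := @sqrt_near1 R X (t^-1%:C *: h).
- by rewrite starZr hs.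
- rewrite (_ : 1 - _ = t^-1%:C *: (t%:C *: 1 - h)); last first.
    by rewrite scalerBr scalerA -rmorphM /= mulVf // scale1r.
  rewrite cnormZr ger0_norm ?invr_ge0 // -(mulVf tn0).
  by rewrite ler_wpM2l // invr_ge0.
exists ((Num.sqrt t)%:C *: s); split.
- apply: cposZ; first exact: sqrtr_ge0.
  by split=> //; exists 1; rewrite scale1r.
- rewrite -scalerAl -scalerAr scalerA -rmorphM -expr2 sqr_sqrtr // sE.
  by rewrite scalerA -rmorphM /= divff // scale1r.
move=> b bh; rewrite -scalerAr -scalerAl comm //.
by rewrite -scalerAr -scalerAl bh.
Qed.

(** The roots [s] of [h] and [u] of [k] satisfy [u * u = - (s * s)], so they commute, and
    [cnorm_cartesian_le] bounds [cnorm s ^+ 2] by the norm of [h + k]. This says that the cone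
    contains no line. *)
Lemma cpos_add_eq0 h k : cpos h -> cpos k -> h + k = 0 -> h = 0.
Proof.
move=> /cpos_sqrt [s [[ss _] <- cs]] /cpos_sqrt [u [[us _] <- cu]] e.
have kE : u * u = - (s * s) by apply/eqP; rewrite -addr_eq0 addrC e.
have su : s * u = u * s.
  by apply: cu; rewrite kE mulrN mulNr mulrA.
have := cnorm_cartesian_le us ss (esym su); rewrite addrC e cnorm0.
rewrite -cnorm_sqr // => le0; apply: cnorm_eq0; apply/eqP.
by rewrite eq_le le0 cnorm_ge0.
Qed.

Lemma cposM h k : cpos h -> cpos k -> h * k = k * h -> cpos (h * k).
Proof.
move=> /cpos_sqrt [s [[ss _] hE cs]] /cpos_sqrt [u [[us _] kE cu]] hk.
have sk : s * k = k * s by rewrite cs.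
have su : s * u = u * s by apply: cu.
have -> : h * k = (s * u) * (s * u).
  by rewrite -hE -kE -!mulrA (mulrA u) -su !mulrA.
by apply: cpos_sqr; rewrite starM us ss su.
Qed.

(** The difference is positive with witness [cnorm h]. For [h = star a * a] the norm bound on [a]
    becomes an identity, which is exploited in [state_contract]. *)
Lemma cpos_norm_sub h : star h = h -> exists d, star d = d /\
  d * d = (cnorm h)%:C *: 1 - h.
Proof.
move=> hs; suff : cpos ((cnorm h)%:C *: 1 - h).
  by move=> /cpos_sqrt [d [[ds _] dE _]]; exists d.
split; first by rewrite starB starZr star1 hs.
by exists (cnorm h); rewrite subKr.
Qed.

(* With m the square root of h^2 the two parts are x = (m + h)/2 and
   x - h = (m - h)/2.  Since x^2 = x m, the difference y between x and the
   square root s of x^2 satisfies y^2 (s m) + y^2 s^2 = 0, which forces y = 0,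
   so that x is positive. *)
Lemma half_abs_cpos h m : star h = h -> cpos m -> m * m = h * h ->
  h * m = m * h -> cpos (2^-1%:C *: (m + h)).
Proof.
move=> hs mp mE hm; set x := _ *: _.
have xs : star x = x by rewrite starZr starD hs mp.1.
have xm : x * m = m * x by rewrite -scalerAl -scalerAr mulrDl mulrDr hm.
have xx : x * x = x * m.
  rewrite -[in LHS]scalerAr -[in RHS]scalerAl -[x * _]scalerAl.
  by rewrite mulrDl !mulrDr -mE -hm [h * m + _]addrC scale_half mulrDl.
have [s [sp sE sc]] := cpos_sqrt (cpos_sqr xs).
have xsc : x * s = s * x by apply: sc; rewrite mulrA.
have ms : m * s = s * m by apply: sc; rewrite !mulrA -xm -!mulrA -xm.
set y := s - x.
have yx : y * x = - (y * s).
  by apply/eqP; rewrite -addr_eq0 -mulrDr /y mulrBl !mulrDr sE xsc addrKA subrr.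
have ys : star y = y by rewrite starB sp.1 xs.
have ysC : y * s = s * y by rewrite mulrBl mulrBr xsc.
have ymC : y * m = m * y by rewrite mulrBl mulrBr xm ms.
have e : y * y * (s * m) + y * y * (s * s) = 0.
  rewrite -!mulrA -mulrDr (_ : y * (s * m) + _ = 0) ?mulr0 //.
  have -> : y * (s * m) = - (y * (x * x)) by rewrite xx !mulrA yx mulNr opprK.
  by rewrite sE addNr.
have p1 : cpos (y * y * (s * m)).
  apply: cposM; [exact: cpos_sqr | exact: cposM|].
  by rewrite !mulrA -(mulrA y y s) ysC mulrA ysC -!mulrA ymC (mulrA y m) ymC !mulrA.
have p2 : cpos (y * y * (s * s)).
  apply: cposM; [exact: cpos_sqr | exact: cpos_sqr sp.1|].
  by rewrite !mulrA -(mulrA y y s) ysC mulrA ysC -!mulrA ysC (mulrA y s) ysC !mulrA.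
have ys0 : y * s = 0.
  apply: selfadj_sqr_eq0; first by rewrite starM ys sp.1 ysC.
  have := cpos_add_eq0 p2 p1; rewrite addrC => /(_ e) <-.
  by rewrite !mulrA -(mulrA y s y) -ysC !mulrA.
have -> : x = s; last by [].
apply/esym/eqP; rewrite -subr_eq0 -/y; apply/eqP; apply: selfadj_sqr_eq0 => //.
by rewrite {2}/y mulrBr ys0 yx ys0 oppr0 subrr.
Qed.

(** [m] is the absolute value of [h]; the halves [(m + h) / 2] and [(m - h) / 2] multiply to
    [(m^2 - h^2) / 4 = 0]. *)
Lemma cpos_decomp h : star h = h ->
  exists p n, [/\ cpos p, cpos n, h = p - n & p * n = 0].
Proof.
move=> hs; have [m [mp mE mc]] := cpos_sqrt (cpos_sqr hs).
have hm : h * m = m * h by apply: mc; rewrite mulrA.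
exists (2^-1%:C *: (m + h)), (2^-1%:C *: (m - h)); split.
- exact: half_abs_cpos.
- apply: half_abs_cpos => //; first by rewrite starN hs.
    by rewrite mulrNN.
  by rewrite mulrN mulNr hm.
- by rewrite -scalerBr opprB addrC subrKA scale_half.
by rewrite -scalerAl -scalerAr mulrDl !mulrBr mE hm addrA subrK subrr !scaler0.
Qed.

Lemma cartesian x : exists h k, [/\ star h = h, star k = k & x = h + 'i *: k].
Proof.
exists (2^-1%:C *: (x + star x)), (2^-1%:C *: (- 'i *: (x - star x))).
have ci : ((- 'i : R[i])^*)%R = 'i by apply/eqP; rewrite eq_complex /= oppr0 opprK !eqxx.
split.
- by rewrite starZr starD starK addrC.
- by rewrite starZr starZ ci starB starK scaleNr -scalerN opprB.
have -> : 'i *: (2^-1%:C *: (- 'i *: (x - star x))) = 2^-1%:C *: (x - star x).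
  by rewrite !scalerA mulrAC mulrN mulii opprK mul1r.
rewrite -scalerDr addrACA subrr addr0.
by rewrite scale_half.
Qed.

(** For [x = h + 'i *: k] the mixed terms cancel and [2 (h^2 + k^2)] remains. *)
Lemma cpos_star_mul_add x : cpos (star x * x + x * star x).
Proof.
have [h [k [hs ks ->]]] := cartesian x.
rewrite starD starZ hs ks conj_i.
have -> : (h + - 'i *: k) * (h + 'i *: k) + (h + 'i *: k) * (h + - 'i *: k)
    = (h * h + k * k) + (h * h + k * k); last first.
  by apply: cposD; apply: cposD; apply: cpos_sqr.
rewrite !mulrDl !mulrDr -!scalerAl -!scalerAr !scalerA.
rewrite mulrN mulNr mulii opprK !scale1r !scaleNr.
by rewrite addrACA [X in X + _]addrACA subrr addr0 [X in _ + X]addrACA addNr add0r addrACA.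
Qed.

(* For e = c d^(1/2) both e* e = - d^2 and e e* = - (c c* )^2 are negative while
   their sum is positive. *)
Lemma star_mul_neg c d : cpos d -> star c * c = - d -> d = 0.
Proof.
move=> dp cE; have [q [qp qE _]] := cpos_sqrt dp.
pose e := c * q.
have e1 : star e * e = - (d * d).
  rewrite starM qp.1 !mulrA -(mulrA q) cE mulrN mulNr -qE.
  by rewrite !mulrA.
have e2 : e * star e = - (c * star c * (c * star c)).
  rewrite /e starM qp.1 (mulrA (c * q)) -(mulrA c q q) qE -[d]opprK -cE.
  by rewrite mulrN mulNr !mulrA.
have p := cpos_star_mul_add e; rewrite e1 e2 in p.
have p1 := cpos_sqr dp.1.
have p2 : cpos (c * star c * (c * star c)).
  by apply: cpos_sqr; rewrite starM starK.
apply: selfadj_sqr_eq0 dp.1 _.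
apply: cpos_add_eq0 p1 (cposD p2 p) _.
by rewrite -opprD addrA subrr.
Qed.

(** Let [n] be the negative part of [star a * a]. Then [c = a * n] has [star c * c = - n^3], and
    [star_mul_neg] forces [n^3 = 0]. *)
Lemma cpos_star_mul a : cpos (star a * a).
Proof.
have hs : star (star a * a) = star a * a by rewrite starM starK.
have [p [n [pp np hE pn]]] := cpos_decomp hs.
have np0 : n * p = 0 by rewrite -pp.1 -np.1 -starM pn star0.
have n3 : star (a * n) * (a * n) = - (n * n * n).
  by rewrite starM np.1 !mulrA -(mulrA n (star a) a) hE mulrBr np0 sub0r mulNr.
have nn : cpos (n * n * n).
  by apply: cposM => //; [exact: cpos_sqr np.1 | rewrite mulrA].
have n0 := star_mul_neg nn n3.
have -> : star a * a = p; last exact: pp.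
rewrite hE (_ : n = 0) ?subr0 //.
(* From [n^3 = 0] follows [n^4 = 0], then [n^2 = 0] and [n = 0], each time because a self-adjoint
   element with zero square vanishes. *)
apply: (selfadj_sqr_eq0 np.1); apply: selfadj_sqr_eq0; first by rewrite starM np.1.
by rewrite mulrA n0 mul0r.
Qed.

End Positive.

(** * States *)

Section States.
Local Open Scope classical_set_scope.
Variables (R : realType) (X : cstarAlgType R).
Implicit Types (x y : X) (r t c : R) (g G : set (X * R)).

(** Models the real part of a state. Invariance under [star] makes the form [f (star x * y)]
    symmetric, so real Cauchy-Schwarz and real symmetric matrices apply. *)
Record real_state (f : X -> R) : Prop := RealState {
  stateD : forall x y, f (x + y) = f x + f y;
  stateZ : forall r x, f (r%:C *: x) = r * f x;
  state1 : f 1 = 1;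
  state_star : forall x, f (star x) = f x;
  state_ge0 : forall x, 0 <= f (star x * x)
}.

(** A partial real-linear functional, kept as its graph so that extension is inclusion. The
    one-sided bound makes the graph single-valued: the difference of two values over one point is a
    value over [0], hence at most [0]. *)
Definition dominated_graph G :=
  (forall p q r, G p -> G q -> G (p.1 + r%:C *: q.1, p.2 + r * q.2)) /\
  (forall p, G p -> p.2 <= cnorm p.1).

Definition unit_line : set (X * R) := [set p | p.1 = p.2%:C *: 1].

Lemma unit_line_dominated : dominated_graph unit_line.
Proof.
split=> [[x a] [y b] r | [x a]]; rewrite /unit_line /= => ->.
  by move=> ->; rewrite scalerA -rmorphM -scalerDl -rmorphD.
by rewrite cnorm_alg ler_norm.
Qed.

(** The one-dimensional Hahn-Banach step: every [p.2 - cnorm (p.1 - x)] lies below every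
    [cnorm (q.1 + x) - q.2], and [c] is the supremum of the former. A point [x] already in the
    domain needs no separate case, since domination then forces [c] to be its value. *)
Lemma dominated_graph_extend G x : dominated_graph G -> G (0, 0) ->
  exists c G', [/\ dominated_graph G', G `<=` G' & G' (x, c)].
Proof.
move=> [lin dom] G0; pose S := [set p.2 - cnorm (p.1 - x) | p in G].
have key p q : G p -> G q -> p.2 - cnorm (p.1 - x) <= cnorm (q.1 + x) - q.2.
  move=> Gp Gq; have := dom _ (lin _ _ 1 Gp Gq); rewrite /= scale1r mul1r.
  have := cnormD_le (p.1 - x) (q.1 + x); rewrite addrACA addNr addr0; lra.
have supS : has_sup S.
  split; first by exists (0 - cnorm (0 - x)), (0, 0).
  by exists (cnorm (0 + x) - 0) => _ [p Gp <-]; exact: (key p (0, 0)).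
pose c := sup S.
have up p : G p -> p.2 - c <= cnorm (p.1 - x).
  move=> Gp; have : p.2 - cnorm (p.1 - x) <= c by apply: ub_le_sup; [case: supS | exists p].
  lra.
have dn p : G p -> p.2 + c <= cnorm (p.1 + x).
  move=> Gp; have : c <= cnorm (p.1 + x) - p.2.
    by apply: ge_sup; [case: supS | move=> _ [q Gq <-]; exact: key].
  lra.
have scal p r : G p -> G (r%:C *: p.1, r * p.2).
  by move=> Gp; have := lin _ _ r G0 Gp; rewrite /= !add0r.
exists c, [set q | exists p r, G p /\ q = (p.1 + r%:C *: x, p.2 + r * c)].
split; last 1 first.
- by exists (0, 0), 1; split => //; rewrite /= !add0r scale1r mul1r.
- split=> [_ _ r [p [a [Gp ->]]] [q [b [Gq ->]]]|_ [p [a [Gp ->]]]] /=.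
    exists (p.1 + r%:C *: q.1, p.2 + r * q.2), (a + r * b); split; first exact: lin.
    rewrite /=; congr (_, _); last by ring.
    by rewrite scalerDr rmorphD rmorphM scalerDl scalerA addrACA.
  have inv r : 0 < r -> r%:C *: (r^-1%:C *: p.1) = p.1 /\ r * (r^-1 * p.2) = p.2.
    move=> r0; rewrite scalerA -rmorphM /= divff ?lt0r_neq0 // scale1r; split => //.
    by rewrite mulrA divff ?lt0r_neq0 // mul1r.
  have [a0|a0|<-] := ltgtP 0 a.
  + have [e1 e2] := inv _ a0.
    have -> : p.1 + a%:C *: x = a%:C *: (a^-1%:C *: p.1 + x) by rewrite scalerDr e1.
    have -> : p.2 + a * c = a * (a^-1 * p.2 + c) by rewrite mulrDr e2.
    rewrite cnormZr gtr0_norm //.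
    by rewrite (ler_wpM2l (ltW a0)) //; exact: (dn _ (scal _ a^-1 Gp)).
  + have na : 0 < - a by rewrite oppr_gt0.
    have [e1 e2] := inv _ na.
    have -> : p.1 + a%:C *: x = (- a)%:C *: ((- a)^-1%:C *: p.1 - x).
      by rewrite scalerBr e1 rmorphN scaleNr opprK.
    have -> : p.2 + a * c = (- a) * ((- a)^-1 * p.2 - c).
      by rewrite mulrBr e2 mulNr opprK.
    rewrite cnormZr gtr0_norm //.
    by rewrite (ler_wpM2l (ltW na)) //; exact: (up _ (scal _ (- a)^-1 Gp)).
  + by rewrite mul0r scale0r !addr0; exact: dom.
by move=> [y b] Gp; exists (y, b), 0; split=> //=; rewrite mul0r scale0r !addr0.
Qed.

Lemma norming_functional : exists f : X -> R,
  [/\ forall x y, f (x + y) = f x + f y, forall r x, f (r%:C *: x) = r * f x,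
      f 1 = 1 & forall x, f x <= cnorm x].
Proof.
(* The line is joined inside the predicate instead of being required of [g]: the union of the empty
   chain is empty and would not contain it. *)
have [F totF|g [gd gmax]] := @Zorn_bigcup _ [set g | dominated_graph (unit_line `|` g)].
  move=> cF; have [ll ld] := unit_line_dominated.
  split=> [p q r|p]; last first.
    case=> [|[g Fg gp]]; first exact: ld.
    by have [_] := totF g Fg; apply; right.
  have via g : F g -> (unit_line `|` g) p -> (unit_line `|` g) q ->
      (unit_line `|` \bigcup_(X0 in F) X0) (p.1 + r%:C *: q.1, p.2 + r * q.2).
    move=> Fg gp gq; have [+ _] := totF g Fg => /(_ _ _ r gp gq) [|h]; first by left.
    by right; exists g.
  case=> [lp|[g Fg gp]] [lq|[h Fh hq]].
  - by left; apply: ll.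
  - by apply: (via h) => //; [left|right].
  - by apply: (via g) => //; [right|left].
  have [gh|hg] := cF _ _ Fg Fh.
    by apply: (via h) => //; right => //; apply: gh.
  by apply: (via g) => //; right => //; apply: hg.
set G := unit_line `|` g in gd.
have G0 : G (0, 0) by left; rewrite /unit_line /= scale0r.
have tot x : exists r, G (x, r).
  have [c [G' [G'd GG' G'x]]] := dominated_graph_extend x gd G0.
  apply: contrapT => nx; apply: (gmax G').
    split=> [p gp|G'g]; first by apply: GG'; right.
    by apply: nx; exists c; right; apply: G'g.
  by rewrite /= (_ : _ `|` G' = G') //; apply/setUidPr => p lp; apply: GG'; left.
have [lin dom] := gd.
have le x r s : G (x, r) -> G (x, s) -> r <= s.
  move=> Gr Gs; have := dom _ (lin _ _ (-1) Gr Gs).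
  by rewrite /= rmorphN1 scaleN1r subrr cnorm0 mulN1r subr_le0.
have uniq x r s : G (x, r) -> G (x, s) -> r = s.
  by move=> Gr Gs; apply/eqP; rewrite eq_le (le x) // (le x).
have [f fG] := choice tot; exists f; split.
- move=> x y; apply: (uniq (x + y)) => //.
  by have := lin _ _ 1 (fG x) (fG y); rewrite /= scale1r mul1r.
- move=> r x; apply: (uniq (r%:C *: x)) => //.
  by have := lin _ _ r G0 (fG x); rewrite /= !add0r.
- by apply: (uniq 1) => //; left; rewrite /unit_line /= scale1r.
by move=> x; have := dom _ (fG x).
Qed.

(** If [t] witnesses [cpos h], then [t - f h = f (t%:C *: 1 - h) <= t], so [f h >= 0]. Averaging
    over [star] gives the invariance and keeps the values on self-adjoint elements. *)
Lemma exists_real_state : exists f : X -> R, real_state f.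
Proof.
have [f [fD fZ f1 fle]] := norming_functional.
have fpos h : cpos h -> 0 <= f h.
  case=> _ [t]; have := fle (t%:C *: 1 - h).
  rewrite fD fZ f1 -[- h]scaleN1r -(rmorphN1 (real_complex R)) fZ; lra.
exists (fun x => (f x + f (star x)) / 2); split.
- by move=> x y; rewrite starD !fD addrACA mulrDl.
- by move=> r x; rewrite starZr !fZ -mulrDr mulrA.
- by rewrite star1 f1; lra.
- by move=> x; rewrite starK addrC.
move=> x; have := fpos _ (cpos_star_mul x); have := fpos _ (cpos_star_mul x).
rewrite starM starK; lra.
Qed.

End States.

(** * Completion of a pre-C*-algebra *)

(** The laws hold on a subset [pdom] of an ambient vector space. Two such subsets occur: the
    finitely supported functionals among all functionals, and a corner [p X p] inside [X]. *)
Record preStar (R : realType) (V : lmodType R[i]) := PreStar {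
  pdom : V -> Prop;
  pone : V;
  pmul : V -> V -> V;
  pstar : V -> V;
  pdom1 : pdom pone;
  pdomD : forall x y, pdom x -> pdom y -> pdom (x + y);
  pdomZ : forall a x, pdom x -> pdom (a *: x);
  pdomM : forall x y, pdom x -> pdom y -> pdom (pmul x y);
  pdomS : forall x, pdom x -> pdom (pstar x);
  pmulA : forall x y z, pdom x -> pdom y -> pdom z ->
    pmul x (pmul y z) = pmul (pmul x y) z;
  pmul1l : forall x, pdom x -> pmul pone x = x;
  pmul1r : forall x, pdom x -> pmul x pone = x;
  pmulDl : forall x y z, pdom x -> pdom y -> pdom z ->
    pmul (x + y) z = pmul x z + pmul y z;
  pmulDr : forall x y z, pdom x -> pdom y -> pdom z ->
    pmul x (y + z) = pmul x y + pmul x z;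
  pmulZl : forall a x y, pdom x -> pdom y -> pmul (a *: x) y = a *: pmul x y;
  pmulZr : forall a x y, pdom x -> pdom y -> pmul x (a *: y) = a *: pmul x y;
  pstarK : forall x, pdom x -> pstar (pstar x) = x;
  pstarD : forall x y, pdom x -> pdom y -> pstar (x + y) = pstar x + pstar y;
  pstarZ : forall a x, pdom x -> pstar (a *: x) = (a^*)%R *: pstar x;
  pstarM : forall x y, pdom x -> pdom y ->
    pstar (pmul x y) = pmul (pstar y) (pstar x)
}.

(** [pnorm] may be a seminorm: its kernel disappears in the quotient by null sequences, and [pnorm1]
    keeps that quotient nonzero. *)
Record preCStar (R : realType) (V : lmodType R[i]) := PreCStar {
  preCStar_preStar :> preStar V;
  pnorm : V -> R;
  pnorm_ge0 : forall x, pdom preCStar_preStar x -> 0 <= pnorm x;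
  pnormD : forall x y, pdom preCStar_preStar x -> pdom preCStar_preStar y ->
    pnorm (x + y) <= pnorm x + pnorm y;
  pnormZ : forall a x, pdom preCStar_preStar x ->
    pnorm (a *: x) = Normc.normc a * pnorm x;
  pnormM : forall x y, pdom preCStar_preStar x -> pdom preCStar_preStar y ->
    pnorm (pmul preCStar_preStar x y) <= pnorm x * pnorm y;
  pnorm_starM : forall x, pdom preCStar_preStar x ->
    pnorm (pmul preCStar_preStar (pstar preCStar_preStar x) x) = pnorm x ^+ 2;
  pnorm1 : pnorm (pone preCStar_preStar) != 0
}.

Section PreStar.
Variables (R : realType) (V : lmodType R[i]) (A : preStar V).
Local Notation dom := (pdom A).
Implicit Types (x y : V).

Lemma pdomN x : dom x -> dom (- x).
Proof. by rewrite -scaleN1r; exact: pdomZ. Qed.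

Lemma pdomB x y : dom x -> dom y -> dom (x - y).
Proof. by move=> dx /pdomN; exact: pdomD. Qed.

Lemma pdom0 : dom 0.
Proof. by rewrite -(scale0r (pone A)); apply: pdomZ; exact: pdom1. Qed.

Lemma pstarN x : dom x -> pstar A (- x) = - pstar A x.
Proof. by move=> dx; rewrite -scaleN1r pstarZ // rmorphN1 scaleN1r. Qed.

Lemma pmulNl x y : dom x -> dom y -> pmul A (- x) y = - pmul A x y.
Proof. by move=> dx dy; rewrite -scaleN1r pmulZl // scaleN1r. Qed.

Lemma pmulNr x y : dom x -> dom y -> pmul A x (- y) = - pmul A x y.
Proof. by move=> dx dy; rewrite -scaleN1r pmulZr // scaleN1r. Qed.

End PreStar.

Section Completion.
Import numFieldNormedType.Exports.
Import generic_quotient.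
Local Open Scope classical_set_scope.
Local Open Scope quotient_scope.
Variables (R : realType) (V : lmodType R[i]) (A : preCStar V).
Local Notation dom := (pdom A).
Local Notation mulp := (pmul A).
Local Notation starp := (pstar A).
Local Notation norm := (pnorm A).
Implicit Types (u v w : nat -> V) (x y z : V) (e : R) (a : R[i]).

Lemma pnorm0 : norm 0 = 0.
Proof. by rewrite -(scale0r 0) pnormZ ?Normc.normc0 ?mul0r //; exact: pdom0. Qed.

Lemma pnormN x : dom x -> norm (- x) = norm x.
Proof. by move=> dx; rewrite -scaleN1r pnormZ // normcN Normc.normc1 mul1r. Qed.

Lemma pnormBC x y : dom x -> dom y -> norm (x - y) = norm (y - x).
Proof. by move=> dx dy; rewrite -opprB pnormN //; exact: pdomB. Qed.

Lemma pnorm_dist x y z : dom x -> dom y -> dom z ->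
  norm (x - z) <= norm (x - y) + norm (y - z).
Proof.
by move=> dx dy dz; rewrite -[x - z](subrKA y) pnormD //; exact: pdomB.
Qed.

Lemma pnorm_star x : dom x -> norm (starp x) = norm x.
Proof.
suff le y : dom y -> norm y <= norm (starp y).
  move=> dx; apply/eqP; rewrite eq_le le // andbT -{2}[x](pstarK dx) le //.
  exact: pdomS.
move=> dy; have := pnorm_ge0 dy; rewrite le_eqVlt => /predU1P [<-|y0].
  by apply: pnorm_ge0; exact: pdomS.
rewrite -(ler_pM2r y0) -expr2 -pnorm_starM //.
by apply: pnormM => //; exact: pdomS.
Qed.

(** * Cauchy sequences of elements of the domain *)

Definition null u := forall e, 0 < e ->
  exists N : nat, forall n, (N <= n)%N -> norm (u n) < e.

Definition cauchy_in u := (forall n, dom (u n)) /\ forall e, 0 < e ->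
  exists N : nat, forall m n, (N <= m)%N -> (N <= n)%N -> norm (u m - u n) < e.

Definition cseq := {u : nat -> V | `[< cauchy_in u >]}.
HB.instance Definition _ := Choice.on cseq.
Implicit Types s t : cseq.

Lemma cseqP s : cauchy_in (val s). Proof. exact/asboolP/(valP s). Qed.
Lemma cseq_dom s n : dom (val s n). Proof. exact: (cseqP s).1. Qed.

Definition mkseq u (uC : cauchy_in u) : cseq := exist _ u (introT (asboolP _) uC).

Lemma cseq_bounded s : exists M : R, 0 < M /\
  exists N : nat, forall n, (N <= n)%N -> norm (val s n) <= M.
Proof.
have [N hN] := (cseqP s).2 1 ltr01.
have d n := cseq_dom s n.
exists (norm (val s N) + 1); split; first by rewrite ltr_wpDl // pnorm_ge0.
exists N => n Nn; have := hN n N Nn (leqnn N).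
have := pnormD (pdomB (d n) (d N)) (d N); rewrite subrK; lra.
Qed.

Lemma cauchy_cst x : dom x -> cauchy_in (fun=> x).
Proof.
by move=> dx; split=> // e e0; exists 0%N => m n _ _; rewrite subrr pnorm0.
Qed.

Lemma cauchy_add s t : cauchy_in (fun n => val s n + val t n).
Proof.
split=> [n|e e0]; first by apply: pdomD; exact: cseq_dom.
have e2 : 0 < e / 2 by rewrite divr_gt0.
have [[M hM] [N hN]] := ((cseqP s).2 _ e2, (cseqP t).2 _ e2).
exists (maxn M N) => m n; rewrite !geq_max => /andP [Mm Nm] /andP [Mn Nn].
have d k := cseq_dom s k; have d' k := cseq_dom t k.
have := pnormD (pdomB (d m) (d n)) (pdomB (d' m) (d' n)).
rewrite addrACA -opprD; have := hM _ _ Mm Mn; have := hN _ _ Nm Nn; lra.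
Qed.

Lemma cauchy_scale a s : cauchy_in (fun n => a *: val s n).
Proof.
split=> [n|e e0]; first by apply: pdomZ; exact: cseq_dom.
have c0 : 0 <= Normc.normc a by case: a => b c; exact: sqrtr_ge0.
have [|N hN] := (cseqP s).2 (e / (Normc.normc a + 1)).
  by rewrite divr_gt0 // ltr_wpDl.
exists N => m n Nm Nn; have := hN m n Nm Nn; rewrite ltr_pdivlMr ?ltr_wpDl //.
have d k := cseq_dom s k; have db := pdomB (d m) (d n).
rewrite -scalerBr pnormZ //; have := pnorm_ge0 db; nra.
Qed.

Lemma pmul_diff x x' y y' : dom x -> dom x' -> dom y -> dom y' ->
  norm (mulp x y - mulp x' y') <= norm (x - x') * norm y + norm x' * norm (y - y').
Proof.
move=> dx dx' dy dy'.
have -> : mulp x y - mulp x' y' = mulp (x - x') y + mulp x' (y - y').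
  rewrite pmulDl ?pmulDr ?pmulNl ?pmulNr //; try exact: pdomN.
  by rewrite addrA subrK.
apply: le_trans (pnormD _ _) _; try by apply: pdomM => //; exact: pdomB.
by rewrite lerD // pnormM //; exact: pdomB.
Qed.

Lemma small_prod (e M M' : R) : 0 < e -> 0 < M -> 0 < M' -> exists2 d, 0 < d &
  forall p q r s : R, 0 <= p -> p < d -> 0 <= q -> q <= M -> 0 <= r -> r <= M' ->
    0 <= s -> s < d -> p * q + r * s < e.
Proof.
move=> e0 M0 M0'; exists (e / (M + M')); first by rewrite divr_gt0 // addr_gt0.
have dE : e / (M + M') * (M + M') = e by rewrite divfK // lt0r_neq0 // addr_gt0.
move: (e / _) dE => d dE p q r s p0 pd q0 qM r0 rM s0 sd.
have h1 : p * q <= p * M by rewrite ler_wpM2l.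
have h2 : r * s <= M' * s by rewrite ler_wpM2r.
have h3 : p * M < d * M by rewrite ltr_pM2r.
have h4 : M' * s < M' * d by rewrite ltr_pM2l.
lra.
Qed.

Lemma cauchy_mul s t : cauchy_in (fun n => mulp (val s n) (val t n)).
Proof.
split=> [n|e e0]; first by apply: pdomM; exact: cseq_dom.
have [M [M0 [N hN]]] := cseq_bounded s.
have [M' [M0' [N' hN']]] := cseq_bounded t.
have [d d0 hd] := small_prod e0 M0' M0.
have [[P hP] [Q hQ]] := ((cseqP s).2 _ d0, (cseqP t).2 _ d0).
exists (maxn (maxn N N') (maxn P Q)) => m n.
rewrite !geq_max => /andP [/andP [m1 m2] /andP [m3 m4]].
move=> /andP [/andP [n1 n2] /andP [n3 n4]].
have ds k := cseq_dom s k; have dt k := cseq_dom t k.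
apply: le_lt_trans (pmul_diff _ _ _ _) _ => //.
apply: hd; rewrite ?pnorm_ge0 ?hN ?hN' ?hP ?hQ //; exact: pdomB.
Qed.

Lemma cauchy_star s : cauchy_in (fun n => starp (val s n)).
Proof.
split=> [n|e e0]; first by apply: pdomS; exact: cseq_dom.
have [N hN] := (cseqP s).2 _ e0; exists N => m n Nm Nn.
have ds k := cseq_dom s k.
rewrite -pstarN // -pstarD //; last exact: pdomN.
by rewrite pnorm_star ?hN //; exact: pdomB.
Qed.

(** * The quotient by null sequences and its algebra structure *)

Definition ceq s t := `[< null (fun n => val s n - val t n) >].

Lemma ceq_refl : reflexive ceq.
Proof.
by move=> s; apply/asboolP => e e0; exists 0%N => n _; rewrite subrr pnorm0.
Qed.

Lemma ceq_sym : symmetric ceq.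
Proof.
suff h s t : ceq s t -> ceq t s by move=> s t; apply/idP/idP; exact: h.
move=> /asboolP st; apply/asboolP => e /st [N hN]; exists N => n /hN.
by rewrite pnormBC //; exact: cseq_dom.
Qed.

Lemma ceq_trans : transitive ceq.
Proof.
move=> t s w /asboolP st /asboolP tw; apply/asboolP => e e0.
have e2 : 0 < e / 2 by rewrite divr_gt0.
have [[M hM] [N hN]] := (st _ e2, tw _ e2).
exists (maxn M N) => n; rewrite geq_max => /andP [/hM h1 /hN h2].
have := pnorm_dist (cseq_dom s n) (cseq_dom t n) (cseq_dom w n); lra.
Qed.

Canonical ceq_equiv := EquivRel ceq ceq_refl ceq_sym ceq_trans.

Definition completion := {eq_quot ceq}.
HB.instance Definition _ := Choice.on completion.
HB.instance Definition _ := EqQuotient.on completion.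

Lemma pi_eq s t : null (fun n => val s n - val t n) ->
  \pi_completion s = \pi_completion t.
Proof. by move=> h; apply/eqmodP; apply/asboolP. Qed.

Lemma pi_ext s t : (forall n, val s n = val t n) ->
  \pi_completion s = \pi_completion t.
Proof.
by move=> h; apply: pi_eq => e e0; exists 0%N => n _; rewrite h subrr pnorm0.
Qed.

Lemma repr_null s : null (fun n => val (repr (\pi_completion s)) n - val s n).
Proof.
apply/asboolP; rewrite -[`[< _ >]]/(ceq (repr (\pi_completion s)) s).
by apply/eqmodP; rewrite reprK.
Qed.

(* The operations are locked: rewriting with pi_add and its analogues would
   otherwise see through them. *)
Fact completion_key : unit. Proof. exact: tt. Qed.

Definition qadd : completion -> completion -> completion :=
  locked_with completion_key
    (fun p q => \pi_completion (mkseq (cauchy_add (repr p) (repr q)))).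
Definition qscale : R[i] -> completion -> completion :=
  locked_with completion_key
    (fun a p => \pi_completion (mkseq (cauchy_scale a (repr p)))).
Definition qmul : completion -> completion -> completion :=
  locked_with completion_key
    (fun p q => \pi_completion (mkseq (cauchy_mul (repr p) (repr q)))).
Definition qstar : completion -> completion :=
  locked_with completion_key
    (fun p => \pi_completion (mkseq (cauchy_star (repr p)))).
Definition qcst x (dx : dom x) : completion := \pi_completion (mkseq (cauchy_cst dx)).

Lemma pi_add s t : qadd (\pi_completion s) (\pi_completion t) =
  \pi_completion (mkseq (cauchy_add s t)).
Proof.
rewrite /qadd locked_withE; apply: pi_eq => e e0 /=.
have e2 : 0 < e / 2 by rewrite divr_gt0.
have [[M hM] [N hN]] := (repr_null s e2, repr_null t e2).
exists (maxn M N) => n; rewrite geq_max => /andP [/hM h1 /hN h2].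
have d k := cseq_dom k n.
have := pnormD (pdomB (d (repr (\pi_completion s))) (d s))
  (pdomB (d (repr (\pi_completion t))) (d t)).
rewrite addrACA -opprD; lra.
Qed.

Lemma pi_scale a s : qscale a (\pi_completion s) = \pi_completion (mkseq (cauchy_scale a s)).
Proof.
rewrite /qscale locked_withE; apply: pi_eq => e e0 /=.
have c0 : 0 <= Normc.normc a by case: a => b c; exact: sqrtr_ge0.
have [|N hN] := @repr_null s (e / (Normc.normc a + 1)).
  by rewrite divr_gt0 // ltr_wpDl.
exists N => n Nn; have := hN n Nn; rewrite ltr_pdivlMr ?ltr_wpDl //.
have d k := cseq_dom k n; have db := pdomB (d (repr (\pi_completion s))) (d s).
rewrite -scalerBr pnormZ //; have := pnorm_ge0 db; nra.
Qed.

Lemma pi_mul s t : qmul (\pi_completion s) (\pi_completion t) =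
  \pi_completion (mkseq (cauchy_mul s t)).
Proof.
rewrite /qmul locked_withE; apply: pi_eq => e e0 /=.
have [M [M0 [N hN]]] := cseq_bounded s.
have [M' [M0' [N' hN']]] := cseq_bounded (repr (\pi_completion t)).
have [d d0 hd] := small_prod e0 M0' M0.
have [[P hP] [Q hQ]] := (repr_null s d0, repr_null t d0).
exists (maxn (maxn N N') (maxn P Q)) => n.
rewrite !geq_max => /andP [/andP [m1 m2] /andP [m3 m4]].
have dd k := cseq_dom k n.
apply: le_lt_trans (pmul_diff (dd _) (dd _) (dd _) (dd _)) _.
by apply: hd; rewrite ?pnorm_ge0 ?hN ?hN' ?hP ?hQ //; try apply: pdomB; exact: dd.
Qed.

Lemma pi_star s : qstar (\pi_completion s) = \pi_completion (mkseq (cauchy_star s)).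
Proof.
rewrite /qstar locked_withE; apply: pi_eq => e e0 /=.
have [N hN] := repr_null s e0; exists N => n Nn.
have d k := cseq_dom k n.
rewrite -(pstarN (d s)) -(pstarD (d _) (pdomN (d s))).
by rewrite pnorm_star ?hN //; exact: pdomB.
Qed.

Definition qzero := qcst (pdom0 A).
Definition qone := qcst (pdom1 A).
Definition qopp := qscale (-1).

Lemma qaddA : associative qadd.
Proof.
elim/quotW=> s; elim/quotW=> t; elim/quotW=> w; rewrite !pi_add.
by apply: pi_ext => n /=; rewrite addrA.
Qed.

Lemma qaddC : commutative qadd.
Proof.
elim/quotW=> s; elim/quotW=> t; rewrite !pi_add.
by apply: pi_ext => n /=; rewrite addrC.
Qed.

Lemma qadd0 : left_id qzero qadd.
Proof.
by elim/quotW=> s; rewrite pi_add; apply: pi_ext => n /=; rewrite add0r.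
Qed.

Lemma qaddN : left_inverse qzero qopp qadd.
Proof.
elim/quotW=> s; rewrite /qopp pi_scale pi_add.
by apply: pi_ext => n /=; rewrite scaleN1r addNr.
Qed.

HB.instance Definition _ :=
  GRing.isZmodule.Build completion qaddA qaddC qadd0 qaddN.

Lemma qmulA : associative qmul.
Proof.
elim/quotW=> s; elim/quotW=> t; elim/quotW=> w; rewrite !pi_mul.
by apply: pi_ext => n /=; rewrite pmulA //; exact: cseq_dom.
Qed.

Lemma qmul1l : left_id qone qmul.
Proof.
elim/quotW=> s; rewrite pi_mul.
by apply: pi_ext => n /=; rewrite pmul1l //; exact: cseq_dom.
Qed.

Lemma qmul1r : right_id qone qmul.
Proof.
elim/quotW=> s; rewrite pi_mul.
by apply: pi_ext => n /=; rewrite pmul1r //; exact: cseq_dom.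
Qed.

Lemma qmulDl : left_distributive qmul qadd.
Proof.
elim/quotW=> s; elim/quotW=> t; elim/quotW=> w; rewrite !(pi_add, pi_mul).
by apply: pi_ext => n /=; rewrite pmulDl //; exact: cseq_dom.
Qed.

Lemma qmulDr : right_distributive qmul qadd.
Proof.
elim/quotW=> s; elim/quotW=> t; elim/quotW=> w; rewrite !(pi_add, pi_mul).
by apply: pi_ext => n /=; rewrite pmulDr //; exact: cseq_dom.
Qed.

Lemma qone_neq0 : qone != qzero.
Proof.
apply/negP => /eqP /eqmodP /asboolP h.
have n0 : 0 < norm (pone A) by rewrite lt_def pnorm1 pnorm_ge0 //; exact: pdom1.
by have [N /(_ N (leqnn N))] := h _ n0; rewrite /= subr0 ltxx.
Qed.

HB.instance Definition _ := GRing.Zmodule_isNzRing.Build completion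
  qmulA qmul1l qmul1r qmulDl qmulDr qone_neq0.

Lemma qscaleA a b (p : completion) : qscale a (qscale b p) = qscale (a * b) p.
Proof.
elim/quotW: p => s; rewrite !pi_scale.
by apply: pi_ext => n /=; rewrite scalerA.
Qed.

Lemma qscale1 : left_id 1 qscale.
Proof.
by elim/quotW=> s; rewrite pi_scale; apply: pi_ext => n /=; rewrite scale1r.
Qed.

Lemma qscaleDr : right_distributive qscale +%R.
Proof.
move=> a; elim/quotW=> s; elim/quotW=> t; rewrite -![_ + _]/(qadd _ _).
rewrite !(pi_scale, pi_add).
by apply: pi_ext => n /=; rewrite scalerDr.
Qed.

Lemma qscaleDl (p : completion) : {morph qscale^~ p : a b / a + b}.
Proof.
elim/quotW: p => s a b; rewrite -[_ + qscale _ _]/(qadd _ _).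
rewrite !(pi_scale, pi_add).
by apply: pi_ext => n /=; rewrite scalerDl.
Qed.

HB.instance Definition _ := GRing.Zmodule_isLmodule.Build R[i] completion
  qscaleA qscale1 qscaleDr qscaleDl.

Lemma qscaleAl a (p q : completion) : a *: (p * q) = a *: p * q.
Proof.
rewrite -![_ *: _]/(qscale _ _) -![_ * _]/(qmul _ _).
elim/quotW: p => s; elim/quotW: q => t; rewrite !(pi_scale, pi_mul).
by apply: pi_ext => n /=; rewrite pmulZl //; exact: cseq_dom.
Qed.

HB.instance Definition _ :=
  GRing.Lmodule_isLalgebra.Build R[i] completion qscaleAl.

Lemma qscaleAr a (p q : completion) : a *: (p * q) = p * (a *: q).
Proof.
rewrite -![_ *: _]/(qscale _ _) -![_ * _]/(qmul _ _).
elim/quotW: p => s; elim/quotW: q => t; rewrite !(pi_scale, pi_mul).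
by apply: pi_ext => n /=; rewrite pmulZr //; exact: cseq_dom.
Qed.

HB.instance Definition _ :=
  GRing.Lalgebra_isAlgebra.Build R[i] completion qscaleAr.

(** * The norm of the completion *)

Lemma real_cauchy_cvg (f : R^nat) :
  (forall e, 0 < e -> exists N : nat, forall m n, (N <= m)%N -> (N <= n)%N ->
     `|f m - f n| < e) -> cvgn f.
Proof.
move=> h; apply/cauchy_cvgP/cauchy_exP => e /h [N hN].
by exists (f N); exists N => // n Nn; apply: hN.
Qed.

Lemma pnorm_dist_norm x y : dom x -> dom y -> `|norm x - norm y| <= norm (x - y).
Proof.
move=> dx dy; rewrite ler_norml; apply/andP; split.
  by have := pnormD (pdomB dy dx) dx; rewrite subrK pnormBC //; lra.
by have := pnormD (pdomB dx dy) dy; rewrite subrK; lra.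
Qed.

Definition qnorm (p : completion) : R := limn (fun n => norm (val (repr p) n)).

(** Frees [qnorm] from the representative chosen in its definition; the norm axioms then pass to the
    limit termwise. *)
Lemma qnorm_cvg s : norm (val s n) @[n --> \oo] --> qnorm (\pi_completion s).
Proof.
have cv : norm (val (repr (\pi_completion s)) n) @[n --> \oo]
    --> qnorm (\pi_completion s).
  apply: real_cauchy_cvg => e /(cseqP (repr (\pi_completion s))).2 [N hN].
  exists N => m n Nm Nn; apply: le_lt_trans (hN m n Nm Nn).
  by apply: pnorm_dist_norm; exact: cseq_dom.
apply/cvgrPdist_lt => e e0; have e2 : 0 < e / 2 by rewrite divr_gt0.
have /cvgrPdist_lt /(_ _ e2) [M _ hM] := cv; have [N hN] := repr_null s e2.
exists (maxn M N) => // n /=; rewrite geq_max => /andP [/hM /= h1 /hN h2].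
have := pnorm_dist_norm (cseq_dom (repr (\pi_completion s)) n) (cseq_dom s n).
rewrite [e]splitr => h3.
apply: le_lt_trans (ler_distD (norm (val (repr (\pi_completion s)) n)) _ _) _.
by rewrite ltrD // (le_lt_trans h3).
Qed.

Arguments qnorm_cvg : clear implicits.

Lemma qnorm_le_lim (f g : R^nat) (a b : R) : f n @[n --> \oo] --> a ->
  g n @[n --> \oo] --> b -> (forall n, f n <= g n) -> a <= b.
Proof. by move=> fa gb fg; apply: ler_cvg_to fa gb _; exists 0%N. Qed.

Lemma qnorm_eq_lim (f g : R^nat) (a b : R) : f n @[n --> \oo] --> a ->
  g n @[n --> \oo] --> b -> (forall n, f n = g n) -> a = b.
Proof.
move=> fa gb fg; apply/eqP; rewrite eq_le; apply/andP; split.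
  by apply: qnorm_le_lim fa gb _ => n; rewrite fg.
by apply: qnorm_le_lim gb fa _ => n; rewrite fg.
Qed.

Lemma qstarK : involutive qstar.
Proof.
elim/quotW=> s; rewrite !pi_star.
by apply: pi_ext => n /=; rewrite pstarK //; exact: cseq_dom.
Qed.

Lemma qstarD : {morph qstar : p q / p + q}.
Proof.
move=> p q; rewrite -![_ + _]/(qadd _ _).
elim/quotW: p => s; elim/quotW: q => t; rewrite !(pi_star, pi_add).
by apply: pi_ext => n /=; rewrite pstarD //; exact: cseq_dom.
Qed.

Lemma qstarZ a (p : completion) : qstar (a *: p) = (a^*)%R *: qstar p.
Proof.
rewrite -![_ *: _]/(qscale _ _); elim/quotW: p => s.
rewrite !(pi_star, pi_scale).
by apply: pi_ext => n /=; rewrite pstarZ //; exact: cseq_dom.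
Qed.

Lemma qstarM (p q : completion) : qstar (p * q) = qstar q * qstar p.
Proof.
rewrite -![_ * _]/(qmul _ _).
elim/quotW: p => s; elim/quotW: q => t; rewrite !(pi_star, pi_mul).
by apply: pi_ext => n /=; rewrite pstarM //; exact: cseq_dom.
Qed.

Lemma qnorm_ge0 p : 0 <= qnorm p.
Proof.
elim/quotW: p => s; apply: qnorm_le_lim (cvg_cst 0) (qnorm_cvg s) _ => n.
by apply: pnorm_ge0; exact: cseq_dom.
Qed.

Lemma qnorm_eq0 p : qnorm p = 0 -> p = 0.
Proof.
elim/quotW: p => s s0; apply: pi_eq => e e0 /=.
have := qnorm_cvg s; rewrite s0 => /cvgrPdist_lt /(_ _ e0) [N _ hN].
exists N => n /hN /=; rewrite subr0 sub0r normrN ger0_norm //.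
by apply: pnorm_ge0; exact: cseq_dom.
Qed.

Lemma qnormD_le p q : qnorm (p + q) <= qnorm p + qnorm q.
Proof.
rewrite -![p + q]/(qadd _ _); elim/quotW: p => s; elim/quotW: q => t; rewrite pi_add.
apply: qnorm_le_lim (qnorm_cvg _) (cvgD (qnorm_cvg s) (qnorm_cvg t)) _ => n /=.
by apply: pnormD; exact: cseq_dom.
Qed.

Lemma qnormZ a p : qnorm (a *: p) = Normc.normc a * qnorm p.
Proof.
rewrite -[a *: p]/(qscale _ _); elim/quotW: p => s; rewrite pi_scale.
apply: qnorm_eq_lim (qnorm_cvg _) (cvgM (cvg_cst _) (qnorm_cvg s)) _ => n /=.
by apply: pnormZ; exact: cseq_dom.
Qed.

Lemma qnormM_le p q : qnorm (p * q) <= qnorm p * qnorm q.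
Proof.
rewrite -[p * q]/(qmul _ _); elim/quotW: p => s; elim/quotW: q => t; rewrite pi_mul.
apply: qnorm_le_lim (qnorm_cvg _) (cvgM (qnorm_cvg s) (qnorm_cvg t)) _ => n /=.
by apply: pnormM; exact: cseq_dom.
Qed.

Lemma qnorm_starM p : qnorm (qstar p * p) = qnorm p ^+ 2.
Proof.
rewrite -[_ * _]/(qmul _ _) expr2; elim/quotW: p => s; rewrite pi_star pi_mul.
apply: qnorm_eq_lim (qnorm_cvg _) (cvgM (qnorm_cvg s) (qnorm_cvg s)) _ => n /=.
by rewrite pnorm_starM //; exact: cseq_dom.
Qed.

Lemma qnorm_cst x (dx : dom x) : qnorm (qcst dx) = norm x.
Proof. exact: qnorm_eq_lim (qnorm_cvg _) (cvg_cst (norm x)) _. Qed.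

Lemma qsub_cst x y (dx : dom x) (dy : dom y) : qcst dx - qcst dy = qcst (pdomB dx dy).
Proof.
rewrite -[LHS]/(qadd _ (qscale _ _)) pi_scale pi_add.
by apply: pi_ext => n /=; rewrite scaleN1r.
Qed.

Lemma qcst_dense s e : 0 < e -> exists N : nat, forall n, (N <= n)%N ->
  qnorm (\pi_completion s - qcst (cseq_dom s n)) <= e.
Proof.
move=> e0; have [N hN] := (cseqP s).2 _ e0; exists N => n Nn.
rewrite -[_ - _]/(qadd _ (qscale _ _)) pi_scale pi_add.
apply: ler_cvg_to (qnorm_cvg _) (cvg_cst e) _; exists N => // m /= Nm.
by rewrite scaleN1r ltW // hN.
Qed.

Lemma qnorm_dist p q r : qnorm (p - r) <= qnorm (p - q) + qnorm (q - r).
Proof. by rewrite -[p - r](subrKA q); exact: qnormD_le. Qed.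

Lemma qnormBC p q : qnorm (p - q) = qnorm (q - p).
Proof. by rewrite -opprB -scaleN1r qnormZ normcN Normc.normc1 mul1r. Qed.

(** Constant sequences are dense, so some [w k] in the domain lies within [1 / (k + 1)] of [p k].
    The sequence [w] is Cauchy, and its class is the limit. *)
Lemma qcomplete (p : nat -> completion) :
  (forall e, 0 < e -> exists N : nat, forall m n,
     (N <= m)%N -> (N <= n)%N -> qnorm (p m - p n) < e) ->
  exists q, forall e, 0 < e -> exists N : nat, forall n,
    (N <= n)%N -> qnorm (p n - q) < e.
Proof.
move=> pC.
have approx k : exists x, exists dx : dom x, qnorm (p k - qcst dx) <= k.+1%:R^-1.
  have [|N /(_ N (leqnn N))] := @qcst_dense (repr (p k)) k.+1%:R^-1.
    by rewrite invr_gt0.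
  by rewrite reprK; exists (val (repr (p k)) N), (cseq_dom (repr (p k)) N).
have [w hw] := choice approx.
have dw k : dom (w k) by case: (hw k).
have near_w k : qnorm (p k - qcst (dw k)) <= k.+1%:R^-1.
  case: (hw k) => dx; rewrite (_ : qcst (dw k) = qcst dx) //.
  exact: pi_ext.
have small e : 0 < e -> exists N : nat, forall n, (N <= n)%N -> n.+1%:R^-1 < e.
  move=> e0; have /cvgrPdist_lt /(_ _ e0) [N _ hN] := @cvg_harmonic R.
  by exists N => n /hN /=; rewrite sub0r normrN ger0_norm // invr_ge0.
have third (e x1 x2 x3 x4 x5 h1 h2 : R) : x1 <= h1 -> x2 <= h2 -> h1 < e / 3 ->
    h2 < e / 3 -> x5 < e / 3 -> x4 <= x5 + x1 -> x3 <= x2 + x4 -> x3 < e by lra.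
have wC : cauchy_in w.
  split=> // e e0; have e3 : 0 < e / 3 by rewrite divr_gt0.
  have [[M hM] [N hN]] := (small _ e3, pC _ e3).
  exists (maxn M N) => m n; rewrite !geq_max => /andP [m1 m2] /andP [n1 n2].
  rewrite -(qnorm_cst (pdomB (dw m) (dw n))) -qsub_cst.
  have := qnorm_dist (qcst (dw m)) (p m) (qcst (dw n)).
  rewrite (qnormBC _ (p m)).
  exact: third (near_w n) (near_w m) (hM _ n1) (hM _ m1) (hN _ _ m2 n2)
    (qnorm_dist (p m) (p n) (qcst (dw n))).
exists (\pi_completion (mkseq wC)) => e e0; have e3 : 0 < e / 3 by rewrite divr_gt0.
have [[M hM] [N hN]] := (small _ e3, qcst_dense (mkseq wC) e3).
exists (maxn M N) => n; rewrite geq_max => /andP [n1 n2].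
have h : qnorm (qcst (dw n) - \pi_completion (mkseq wC)) <= e / 3.
  rewrite qnormBC (_ : qcst (dw n) = qcst (cseq_dom (mkseq wC) n)) ?hN //.
  exact: pi_ext.
have half (x1 x2 x3 h1 : R) : x1 <= h1 -> h1 < e / 3 -> x2 <= e / 3 ->
  x3 <= x1 + x2 -> x3 < e by lra.
exact: half (near_w n) (hM _ n1) h (qnorm_dist _ _ _).
Qed.

HB.instance Definition _ := Algebra_isCStar.Build R completion
  qstarK qstarD qstarZ qstarM qnorm_ge0 qnorm_eq0 qnormD_le qnormZ qnormM_le
  qnorm_starM qcomplete.

Lemma preCStar_completion : exists (X : cstarAlgType R) (f : V -> X),
  [/\ forall x y, dom x -> dom y -> f (x + y) = f x + f y,
      forall x y, dom x -> dom y -> f (mulp x y) = f x * f y,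
      f (pone A) = 1, forall x, dom x -> f (starp x) = star (f x)
    & forall x, dom x -> cnorm (f x) = norm x].
Proof.
(* Outside the domain the value is a dummy [0]; the conclusions only speak of arguments in the
   domain. *)
pose f x : completion := if pselect (dom x) is left dx then qcst dx else 0.
have fE x (dx : dom x) : f x = qcst dx.
  by rewrite /f; case: pselect => // dx'; exact: pi_ext.
exists completion, f; split.
- move=> x y dx dy; rewrite (fE _ dx) (fE _ dy) (fE _ (pdomD dx dy)).
  by rewrite -[RHS]/(qadd _ _) pi_add; exact: pi_ext.
- move=> x y dx dy; rewrite (fE _ dx) (fE _ dy) (fE _ (pdomM dx dy)).
  by rewrite -[RHS]/(qmul _ _) pi_mul; exact: pi_ext.
- by rewrite (fE _ (pdom1 A)); exact: pi_ext.
- move=> x dx; rewrite (fE _ dx) (fE _ (pdomS dx)).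
  by rewrite -[RHS]/(qstar _) pi_star; exact: pi_ext.
by move=> x dx; rewrite (fE _ dx); exact: qnorm_cst.
Qed.

End Completion.

(** * The GNS seminorm *)

Lemma discriminant_le (R : realFieldType) (a b c : R) : 0 <= c ->
  (forall r, 0 <= a + 2 * r * b + r ^+ 2 * c) -> b ^+ 2 <= a * c.
Proof.
move=> c0 h; have [c00|cn0] := eqVneq c 0.
  suff -> : b = 0 by rewrite c00 mulr0 expr0n.
  (* For [c = 0] the polynomial is affine, and this [r] gives it the value [-1]. *)
  apply/eqP/negPn/negP => bn0; have := h (- (a + 1) / (2 * b)).
  rewrite c00 mulr0 addr0 (_ : 2 * _ * b = - (a + 1)); last by field.
  lra.
have cp : 0 < c by rewrite lt_def cn0.
have := h (- b / c).
rewrite (_ : _ + _ = (a * c - b ^+ 2) / c); last by field.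
by rewrite pmulr_lge0 ?invr_gt0 // subr_ge0.
Qed.

Section GNS.
Local Open Scope classical_set_scope.
Variables (R : realType) (V : lmodType R[i]) (A : preStar V) (phi : V -> R).
Local Notation dom := (pdom A).
Local Notation mulp := (pmul A).
Local Notation starp := (pstar A).
Hypothesis phiD : forall x y, dom x -> dom y -> phi (x + y) = phi x + phi y.
Hypothesis phiZ : forall (r : R) x, dom x -> phi (r%:C *: x) = r * phi x.
Hypothesis phi_star : forall x, dom x -> phi (starp x) = phi x.
Hypothesis phi_ge0 : forall x, dom x -> 0 <= phi (mulp (starp x) x).
Hypothesis phi1 : phi (pone A) = 1.

Definition gns_form x y := phi (mulp (starp x) y).
Definition gns_len x := Num.sqrt (gns_form x x).
Local Notation "<< x , y >>" := (gns_form x y).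

Lemma gns_formC x y : dom x -> dom y -> <<x, y>> = <<y, x>>.
Proof.
move=> dx dy; rewrite /gns_form -phi_star ?pstarM ?pstarK //; do ?exact: pdomS.
by apply: pdomM => //; exact: pdomS.
Qed.

Lemma gns_formDr x y z : dom x -> dom y -> dom z ->
  <<x, y + z>> = <<x, y>> + <<x, z>>.
Proof.
move=> dx dy dz; have dsx := pdomS dx.
by rewrite /gns_form pmulDr // phiD //; exact: pdomM.
Qed.

Lemma gns_formZr (r : R) x y : dom x -> dom y -> <<x, r%:C *: y>> = r * <<x, y>>.
Proof.
move=> dx dy; have dsx := pdomS dx.
by rewrite /gns_form pmulZr // phiZ //; exact: pdomM.
Qed.

Lemma gns_form_expand x y (r : R) : dom x -> dom y ->
  <<x + r%:C *: y, x + r%:C *: y>> =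
    <<x, x>> + 2 * r * <<x, y>> + r ^+ 2 * <<y, y>>.
Proof.
move=> dx dy; have drx : dom (r%:C *: y) by apply: pdomZ.
have dxy : dom (x + r%:C *: y) by apply: pdomD.
rewrite gns_formDr // gns_formZr // (gns_formC dxy dx) (gns_formC dxy dy).
rewrite !gns_formDr // !gns_formZr // (gns_formC dy dx); ring.
Qed.

Lemma gns_cauchy_schwarz x y : dom x -> dom y ->
  <<x, y>> <= gns_len x * gns_len y.
Proof.
move=> dx dy; rewrite -sqrtrM ?phi_ge0 //; apply: le_trans (ler_norm _) _.
rewrite -sqrtr_sqr ler_wsqrtr // discriminant_le ?phi_ge0 // => r.
by rewrite -gns_form_expand //; apply: phi_ge0; apply: pdomD => //; exact: pdomZ.
Qed.

Lemma gns_len_ge0 x : 0 <= gns_len x. Proof. exact: sqrtr_ge0. Qed.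

Lemma gns_len_sqr x : dom x -> gns_len x ^+ 2 = <<x, x>>.
Proof. by move=> dx; rewrite sqr_sqrtr // phi_ge0. Qed.

Lemma gns_lenD x y : dom x -> dom y -> gns_len (x + y) <= gns_len x + gns_len y.
Proof.
move=> dx dy; have dxy := pdomD dx dy.
rewrite -(@ler_pXn2r _ 2) ?nnegrE ?addr_ge0 ?gns_len_ge0 // gns_len_sqr //.
have := gns_form_expand 1 dx dy; rewrite scale1r => ->.
rewrite sqrrD !gns_len_sqr // mulr1 expr1n mul1r.
have := gns_cauchy_schwarz dx dy; lra.
Qed.

(** Complex homogeneity holds although [phi] is only real linear, because the scalar that comes out
    is the real number [|a|^2]. *)
Lemma gns_lenZ (a : R[i]) x : dom x -> gns_len (a *: x) = Normc.normc a * gns_len x.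
Proof.
move=> dx; rewrite /gns_len /gns_form pstarZ // pmulZl ?pmulZr ?scalerA //; last 3 first.
- exact: pdomS.
- exact: pdomS.
- exact: pdomZ.
have -> : ((a^*)%R * a) = (Normc.normc a ^+ 2)%:C.
  by rewrite mulrC -sqr_normc normc_def rmorphXn; case: (a).
rewrite phiZ; last by apply: pdomM => //; exact: pdomS.
rewrite sqrtrM ?sqr_ge0 // sqrtr_sqr ger0_norm //.
by case: (a) => b c; exact: sqrtr_ge0.
Qed.

Definition gns_bound x (c : R) :=
  0 <= c /\ forall y, dom y -> gns_len (mulp x y) <= c * gns_len y.

Lemma gns_boundD x y c d : dom x -> dom y -> gns_bound x c -> gns_bound y d ->
  gns_bound (x + y) (c + d).
Proof.
move=> dx dy [c0 hc] [d0 hd]; split=> [|z dz]; first exact: addr_ge0.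
rewrite pmulDl // mulrDl; apply: le_trans (gns_lenD _ _) _; try exact: pdomM.
by rewrite lerD ?hc ?hd.
Qed.

Lemma gns_boundZ (a : R[i]) x c : dom x -> gns_bound x c ->
  gns_bound (a *: x) (Normc.normc a * c).
Proof.
have a0 : 0 <= Normc.normc a by case: (a) => b d; exact: sqrtr_ge0.
move=> dx [c0 hc]; split=> [|y dy]; first exact: mulr_ge0.
rewrite pmulZl // gns_lenZ; last exact: pdomM.
by rewrite -mulrA ler_wpM2l // hc.
Qed.

Hypothesis bounded : forall x, dom x -> exists c, gns_bound x c.

(** The operator norm of left multiplication by [x] on the possibly degenerate inner product space
    of [gns_form]. *)
Definition gns_norm x : R := inf [set c | gns_bound x c].

Lemma gns_norm_le x c : gns_bound x c -> gns_norm x <= c.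
Proof. by move=> xc; apply: ge_inf => //; exists 0 => d []. Qed.

Lemma gns_normP x : dom x -> gns_bound x (gns_norm x).
Proof.
move=> dx; have [c0 hc0] := bounded dx; split=> [|y dy].
  by apply: lb_le_inf; [exists c0 | move=> c []].
have [y0|yn0] := eqVneq (gns_len y) 0.
  by rewrite y0 mulr0; have := hc0.2 _ dy; rewrite y0 mulr0.
have yp : 0 < gns_len y by rewrite lt_def yn0 gns_len_ge0.
rewrite -ler_pdivrMr //; apply: lb_le_inf; first by exists c0.
by move=> c [_ hc]; rewrite ler_pdivrMr // hc.
Qed.

Lemma gns_norm_ge0 x : dom x -> 0 <= gns_norm x.
Proof. by case/gns_normP. Qed.

Lemma gns_norm_len x y : dom x -> dom y ->
  gns_len (mulp x y) <= gns_norm x * gns_len y.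
Proof. by move=> dx dy; have [_] := gns_normP dx; apply. Qed.

Lemma gns_normD x y : dom x -> dom y -> gns_norm (x + y) <= gns_norm x + gns_norm y.
Proof.
move=> dx dy; apply: gns_norm_le.
by apply: gns_boundD => //; exact: gns_normP.
Qed.

Lemma gns_normZ_le a x : dom x -> gns_norm (a *: x) <= Normc.normc a * gns_norm x.
Proof.
move=> dx; apply: gns_norm_le.
by apply: gns_boundZ => //; exact: gns_normP.
Qed.

Lemma gns_normZ a x : dom x -> gns_norm (a *: x) = Normc.normc a * gns_norm x.
Proof.
move=> dx; apply/eqP; rewrite eq_le gns_normZ_le //=.
have [->|a0] := eqVneq a 0.
  rewrite Normc.normc0 mul0r; apply: gns_norm_ge0; exact: pdomZ.
have an0 : Normc.normc a != 0.
  by apply: contra a0 => /eqP /Normc.eq0_normc ->.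
have ap : 0 < Normc.normc a.
  by rewrite lt_def an0; case: (a) => b c; exact: sqrtr_ge0.
rewrite mulrC -ler_pdivlMr // mulrC -Normc.normcV.
rewrite -[x in leLHS](scale1r x) -(mulVf a0) -scalerA.
by apply: gns_normZ_le; exact: pdomZ.
Qed.

Lemma gns_normM x y : dom x -> dom y -> gns_norm (mulp x y) <= gns_norm x * gns_norm y.
Proof.
move=> dx dy; apply: gns_norm_le; split=> [|z dz].
  by rewrite mulr_ge0 // gns_norm_ge0.
have dyz := pdomM dy dz.
rewrite -pmulA //; apply: le_trans (gns_norm_len _ _) _ => //.
by rewrite -mulrA ler_wpM2l ?gns_norm_ge0 // gns_norm_len.
Qed.

Lemma gns_adj x y z : dom x -> dom y -> dom z ->
  <<mulp x y, z>> = <<y, mulp (starp x) z>>.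
Proof.
move=> dx dy dz; rewrite /gns_form pstarM // -pmulA //; exact: pdomS.
Qed.

(** Divide by [|x* y|] in [|x* y|^2 = <y, x x* y> <= |y| |x| |x* y|], where [|x|] is the operator
    norm and the other bars are lengths. *)
Lemma gns_norm_star_le x : dom x -> gns_norm (starp x) <= gns_norm x.
Proof.
move=> dx; apply: gns_norm_le; split=> [|y dy]; first exact: gns_norm_ge0.
have dsx := pdomS dx; have dsy := pdomM dsx dy.
have := gns_len_ge0 (mulp (starp x) y); rewrite le_eqVlt => /predU1P [<-|lp].
  by rewrite mulr_ge0 ?gns_norm_ge0 ?gns_len_ge0.
rewrite -(ler_pM2r lp) -expr2 gns_len_sqr // gns_adj // pstarK //.
have dxx := pdomM dx dsy.
apply: le_trans (gns_cauchy_schwarz _ _) _ => //.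
rewrite mulrC [leRHS]mulrAC ler_wpM2r ?gns_len_ge0 //.
exact: gns_norm_len.
Qed.

(** The substantial half is [|x y|^2 = <y, x* x y> <= |x* x| |y|^2], by Cauchy-Schwarz. *)
Lemma gns_norm_starM x : dom x -> gns_norm (mulp (starp x) x) = gns_norm x ^+ 2.
Proof.
move=> dx; have dsx := pdomS dx; have dsxx := pdomM dsx dx.
have n0 := gns_norm_ge0 dx; have n1 := gns_norm_ge0 dsxx.
apply/eqP; rewrite eq_le; apply/andP; split.
  apply: le_trans (gns_normM dsx dx) _; rewrite expr2 ler_wpM2r //.
  exact: gns_norm_star_le.
suff : gns_norm x <= Num.sqrt (gns_norm (mulp (starp x) x)).
  by rewrite -(@ler_pXn2r _ 2) ?nnegrE ?sqrtr_ge0 // sqr_sqrtr.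
apply: gns_norm_le; split=> [|y dy]; first exact: sqrtr_ge0.
have dxy := pdomM dx dy; have dsxxy := pdomM dsx dxy.
rewrite -(@ler_pXn2r _ 2) ?nnegrE ?mulr_ge0 ?sqrtr_ge0 //.
rewrite gns_len_sqr // exprMn sqr_sqrtr // gns_adj //.
apply: le_trans (gns_cauchy_schwarz dy dsxxy) _.
rewrite pmulA // mulrC expr2 mulrA ler_wpM2r ?gns_len_ge0 //.
exact: gns_norm_len.
Qed.

Lemma gns_norm1 : gns_norm (pone A) != 0.
Proof.
apply/eqP => n0; have d1 := pdom1 A.
have q1 : <<pone A, pone A>> = 1.
  by rewrite /gns_form pmul1r ?phi_star //; exact: pdomS.
have := gns_norm_len d1 d1; rewrite n0 mul0r pmul1l //.
by rewrite /gns_len q1 sqrtr1 ler10.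
Qed.

Definition gns_preCStar : preCStar V := PreCStar gns_norm_ge0 gns_normD
  gns_normZ gns_normM gns_norm_starM gns_norm1.

End GNS.

(** * Measures on a monoid with involution *)

(* Measures are encoded as the functionals w |-> sum_i c_i w(m_i) on all
   functions, so that convolution is associative by computation. *)
Section MonoidMeasures.
Variables (R : realType) (M : Type) (m1 : M) (mm : M -> M -> M) (ms : M -> M).
Hypotheses (mmA : associative mm) (m1l : left_id m1 mm) (m1r : right_id m1 mm).
Hypotheses (msK : involutive ms) (msM : forall x y, ms (mm x y) = mm (ms y) (ms x)).

Definition measure := (M -> R[i]) -> R[i]^o.
Implicit Types (s t u : measure) (w : M -> R[i]).

(** The representation is not unique and may repeat points; it is the source of linearity in the
    test function. *)
Definition finsupp t := exists (I : finType) (c : I -> R[i]) (m : I -> M),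
  forall w, t w = \sum_i c i * w (m i).

Definition dirac_at (x : M) : measure := fun w => w x.
Definition conv s t : measure := fun w => s (fun x => t (fun y => w (mm x y))).
Definition mstar t : measure := fun w => conjc (t (fun x => conjc (w (ms x)))).

Lemma finsupp_dirac x : finsupp (dirac_at x).
Proof.
by exists unit, (fun=> 1), (fun=> x) => w; rewrite big_const card_unit /= addr0 mul1r.
Qed.

Lemma finsuppD s t : finsupp s -> finsupp t -> finsupp (s + t).
Proof.
move=> [I [c [m sE]]] [J [d [n tE]]].
exists (I + J)%type, (fun k => match k with inl i => c i | inr j => d j end),
  (fun k => match k with inl i => m i | inr j => n j end) => w.
by rewrite big_sumType /= -sE -tE.
Qed.

Lemma finsuppZ (a : R[i]) t : finsupp t -> finsupp (a *: t).
Proof.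
move=> [I [c [m tE]]]; exists I, (fun i => a * c i), m => w.
rewrite -[LHS]/(a * t w) tE mulr_sumr; apply: eq_bigr => i _.
by rewrite mulrA.
Qed.

Lemma finsupp_conv s t : finsupp s -> finsupp t -> finsupp (conv s t).
Proof.
move=> [I [c [m sE]]] [J [d [n tE]]].
exists (I * J)%type, (fun k => c k.1 * d k.2), (fun k => mm (m k.1) (n k.2)) => w.
rewrite /conv sE -(pair_bigA _ (fun i j => c i * d j * w (mm (m i) (n j)))) /=.
apply: eq_bigr => i _; rewrite tE mulr_sumr; apply: eq_bigr => j _.
by rewrite mulrA.
Qed.

Lemma finsupp_mstar t : finsupp t -> finsupp (mstar t).
Proof.
move=> [I [c [m tE]]]; exists I, (fun i => conjc (c i)), (fun i => ms (m i)) => w.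
rewrite /mstar tE rmorph_sum; apply: eq_bigr => i _.
by rewrite rmorphM /= conjcK.
Qed.

Lemma finsupp_addf t w w' : finsupp t -> t (fun x => w x + w' x) = t w + t w'.
Proof.
move=> [I [c [m tE]]]; rewrite !tE -big_split /=.
by apply: eq_bigr => i _; rewrite mulrDr.
Qed.

Lemma finsupp_scalef t a w : finsupp t -> t (fun x => a * w x) = a * t w.
Proof.
move=> [I [c [m tE]]]; rewrite !tE mulr_sumr.
by apply: eq_bigr => i _; rewrite mulrCA.
Qed.

(** Fubini for finite sums. It is what lets the involution reverse convolutions, since for arbitrary
    functionals the iterated values may differ. *)
Lemma finsupp_exchange s t (F : M -> M -> R[i]) : finsupp s -> finsupp t ->
  s (fun x => t (fun y => F x y)) = t (fun y => s (fun x => F x y)).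
Proof.
move=> [I [c [m sE]]] [J [d [n tE]]]; rewrite sE tE.
under eq_bigr do rewrite tE mulr_sumr.
under [in RHS]eq_bigr do rewrite sE mulr_sumr.
rewrite exchange_big; apply: eq_bigr => j _; apply: eq_bigr => i _.
by rewrite mulrCA.
Qed.

Lemma conv_A s t u : conv s (conv t u) = conv (conv s t) u.
Proof.
apply: funext => w; rewrite /conv; congr s; apply: funext => a; congr t.
by apply: funext => b; congr u; apply: funext => c; rewrite mmA.
Qed.

Lemma conv_1l t : conv (dirac_at m1) t = t.
Proof.
by apply: funext => w; rewrite /conv /dirac_at; congr t; apply: funext => a; rewrite m1l.
Qed.

Lemma conv_1r t : conv t (dirac_at m1) = t.
Proof.
by apply: funext => w; rewrite /conv /dirac_at; congr t; apply: funext => a; rewrite m1r.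
Qed.

Lemma conv_Dr s t u : finsupp s -> conv s (t + u) = conv s t + conv s u.
Proof. by move=> ds; apply: funext => w; apply: finsupp_addf. Qed.

Lemma conv_Zr a s t : finsupp s -> conv s (a *: t) = a *: conv s t.
Proof. by move=> ds; apply: funext => w; apply: finsupp_scalef. Qed.

Lemma mstar_K t : mstar (mstar t) = t.
Proof.
apply: funext => w; rewrite /mstar conjcK; congr t; apply: funext => a.
by rewrite conjcK msK.
Qed.

Lemma mstar_D s t : mstar (s + t) = mstar s + mstar t.
Proof. by apply: funext => w; exact: (rmorphD (@conjc R)). Qed.

Lemma mstar_Z a t : mstar (a *: t) = (a^*)%R *: mstar t.
Proof. by apply: funext => w; rewrite /mstar -[RHS]rmorphM. Qed.

Lemma mstar_conv s t : finsupp s -> finsupp t ->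
  mstar (conv s t) = conv (mstar t) (mstar s).
Proof.
move=> ds dt; apply: funext => w; rewrite /mstar /conv.
rewrite (finsupp_exchange (fun a b => conjc (w (ms (mm a b)))) ds dt).
congr conjc; congr t; apply: funext => b; rewrite conjcK; congr s.
by apply: funext => a; rewrite msM.
Qed.

Definition measure_preStar : preStar measure :=
  @PreStar R measure finsupp (dirac_at m1) conv mstar
    (finsupp_dirac m1) finsuppD finsuppZ finsupp_conv finsupp_mstar
    (fun s t u _ _ _ => conv_A s t u) (fun t _ => conv_1l t)
    (fun t _ => conv_1r t) (fun _ _ _ _ _ _ => erefl)
    (fun s t u ds _ _ => conv_Dr t u ds) (fun _ _ _ _ _ => erefl)
    (fun a s t ds _ => conv_Zr a t ds) (fun t _ => mstar_K t)
    (fun s t _ _ => mstar_D s t) (fun a t _ => mstar_Z a t) mstar_conv.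

Variable phi : M -> R.
Hypotheses (phi1 : phi m1 = 1) (phi_ms : forall x, phi (ms x) = phi x).

Definition kernel_form (I : finType) (c : I -> R) (m : I -> M) : R :=
  \sum_i \sum_j c i * c j * phi (mm (ms (m i)) (m j)).

Hypothesis kernel_ge0 : forall (I : finType) (c : I -> R) m, 0 <= kernel_form c m.
Hypothesis kernel_bounded : forall x, exists C : R, 0 <= C /\
  forall (I : finType) (c : I -> R) m,
    kernel_form c (fun i => mm x (m i)) <= C ^+ 2 * kernel_form c m.

Definition integral t : R := complex.Re (t (fun x => (phi x)%:C)).

Lemma Re_add (a b : R[i]) : complex.Re (a + b) = complex.Re a + complex.Re b.
Proof. by case: a => x y; case: b => u v. Qed.

Lemma Re_sum (I : finType) (F : I -> R[i]) :
  complex.Re (\sum_i F i) = \sum_i complex.Re (F i).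
Proof. by apply: (big_morph _ Re_add). Qed.

(** As [phi] is real, only the real part of [conjc (c i) * c j] counts, which is the product of the
    real parts plus that of the imaginary parts. Positivity for complex coefficients thus reduces to
    the real kernel. *)
Lemma integral_form t (I : finType) (c : I -> R[i]) m :
  (forall w, t w = \sum_i c i * w (m i)) ->
  integral (conv (mstar t) t) = kernel_form (fun i => complex.Re (c i)) m +
                                kernel_form (fun i => complex.Im (c i)) m.
Proof.
move=> tE; rewrite /integral /conv /mstar tE rmorph_sum Re_sum -big_split /=.
apply: eq_bigr => i _; rewrite rmorphM /= conjcK tE mulr_sumr Re_sum -big_split /=.
by apply: eq_bigr => j _; case: (c i) => x y; case: (c j) => u v /=; ring.
Qed.

Let A := measure_preStar.

Lemma integralD s t : pdom A s -> pdom A t -> integral (s + t) = integral s + integral t.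
Proof. by move=> _ _; apply: Re_add. Qed.

Lemma integralZ (r : R) t : pdom A t -> integral (r%:C *: t) = r * integral t.
Proof.
move=> _; rewrite /integral -[(_ *: _) _]/(r%:C * t _).
by case: (t _) => x y /=; ring.
Qed.

Lemma integral_star t : pdom A t -> integral (pstar A t) = integral t.
Proof.
move=> _; rewrite /integral /= /mstar.
rewrite (_ : (fun x => _) = fun x => (phi x)%:C); first by case: (t _).
by apply: funext => x; rewrite conjc_real phi_ms.
Qed.

Lemma integral_ge0 t : pdom A t -> 0 <= integral (pmul A (pstar A t) t).
Proof. by move=> [I [c [m tE]]]; rewrite /= (integral_form tE) addr_ge0. Qed.

Lemma integral_one : integral (pone A) = 1.
Proof. by rewrite /integral /= /dirac_at phi1. Qed.

Lemma dirac_bounded x : exists C, gns_bound A integral (dirac_at x) C.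
Proof.
have [C [C0 hC]] := kernel_bounded x; exists C; split=> // t [I [c [m tE]]].
have CE : C = Num.sqrt (C ^+ 2) by rewrite sqrtr_sqr ger0_norm.
rewrite {1}CE /gns_len -sqrtrM ?sqr_ge0 //.
rewrite ler_wsqrtr // /gns_form.
have xtE w : conv (dirac_at x) t w = \sum_i c i * w (mm x (m i)).
  by rewrite /conv /dirac_at tE.
rewrite [pmul A _ (pmul A _ _)](_ : _ =
  conv (mstar (conv (dirac_at x) t)) (conv (dirac_at x) t)) //.
by rewrite (integral_form xtE) (integral_form tE) mulrDr lerD.
Qed.

Lemma measure_bounded t : pdom A t -> exists C, gns_bound A integral t C.
Proof.
move=> [I [c [m tE]]].
have -> : t = \sum_i c i *: (dirac_at (m i) : measure).
  by apply: funext => w; rewrite tE fct_sumE.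
pose P t := pdom A t /\ exists C, gns_bound A integral t C.
suff [] : P (\sum_i c i *: (dirac_at (m i) : measure)) by [].
apply: big_ind => [|s u [ds [C hC]] [du [D hD]]|i _].
(* The empty sum is written as a multiple of the unit so that the scaling bound covers it. *)
- rewrite -(scale0r (pone A)); split; first by apply: pdomZ; exact: pdom1.
  have [C hC] := dirac_bounded m1; exists (Normc.normc 0 * C).
  by apply: (gns_boundZ integralZ) => //; exact: pdom1.
- split; first exact: pdomD.
  by exists (C + D); exact: (gns_boundD integralD integralZ integral_star integral_ge0).
have dd : pdom A (dirac_at (m i)) by exact: finsupp_dirac.
split; first exact: pdomZ.
have [C hC] := dirac_bounded (m i).
by exists (Normc.normc (c i) * C); exact: (gns_boundZ integralZ).
Qed.

Definition measure_preCStar := gns_preCStar integralD integralZ integral_star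
  integral_ge0 integral_one measure_bounded.

(** The last clause turns relations seen by [phi] into relations of [X]: if no two-sided translate
    separates [x] from [y + z], then [dirac_at x - (dirac_at y + dirac_at z)] maps everything to
    vectors of length zero, so its operator norm is zero. *)
Theorem monoid_cstar : exists (X : cstarAlgType R) (f : M -> X),
  [/\ f m1 = 1, forall x y, f (mm x y) = f x * f y,
      forall x, f (ms x) = star (f x) &
      forall x y z, (forall u v : M, phi (mm u (mm x v)) =
          phi (mm u (mm y v)) + phi (mm u (mm z v))) -> f x = f y + f z].
Proof.
have [X [g [gD gM g1 gS gN]]] := preCStar_completion measure_preCStar.
have dd x : pdom A (dirac_at x) by exact: finsupp_dirac.
exists X, (fun x => g (dirac_at x)); split.
- exact: g1.
- by move=> x y; rewrite -gM.
- move=> x; rewrite -gS //; congr g; apply: funext => w.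
  by rewrite /= /mstar /dirac_at conjcK.
move=> x y z xyz; apply/eqP; rewrite -subr_eq0; apply/eqP/cnorm_eq0/eqP.
pose t : measure := dirac_at x - (dirac_at y + dirac_at z).
have dt : pdom A t by apply: pdomB => //; exact: pdomD.
have gt : g t + (g (dirac_at y) + g (dirac_at z)) = g (dirac_at x).
  rewrite -gD // -gD //; last exact: pdomD.
  by rewrite subrK.
rewrite -gt addrK gN // eq_le (@pnorm_ge0 _ _ measure_preCStar) // andbT.
apply: gns_norm_le; split=> // s ds; rewrite mul0r.
rewrite /gns_len /gns_form (_ : integral _ = 0) ?sqrtr0 //.
rewrite /integral /= /conv.
set F := (fun a : M => _).
have -> : F = fun=> 0.
  apply: funext => a; rewrite /F.
  rewrite (@finsupp_exchange t s (fun b c => (phi (mm a (mm b c)))%:C)) //.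
  (* Zero functions are written as [0 * 0], the form in which [finsupp_scalef] evaluates them to
     zero. *)
  have -> : (fun c => t (fun b => (phi (mm a (mm b c)))%:C)) = fun c => 0 * 0.
    apply: funext => c; rewrite mul0r.
    by rewrite -[LHS]/((phi _)%:C - ((phi _)%:C + (phi _)%:C)) xyz rmorphD subrr.
  by rewrite finsupp_scalef // mul0r.
have -> : (fun=> 0) = (fun c : M => 0 * 0 : R[i]) by apply: funext => c; rewrite mul0r.
by rewrite (finsupp_scalef _ _ (finsupp_mstar (finsupp_conv dt ds))) mul0r.
Qed.

End MonoidMeasures.

(** * Tensor products of states *)

Section Gram.
Variables (R : rcfType) (I : finType).
Implicit Types (Q : I -> I -> R) (c d : I -> R).

Definition bilin Q c d : R := \sum_i \sum_j c i * d j * Q i j.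
Definition possemidef Q := (forall i j, Q i j = Q j i) /\ forall c, 0 <= bilin Q c c.

Lemma bilin_expand Q c d r : possemidef Q ->
  bilin Q (fun i => c i + r * d i) (fun i => c i + r * d i) =
  bilin Q c c + 2 * r * bilin Q c d + r ^+ 2 * bilin Q d d.
Proof.
move=> [Qs _].
have dc : bilin Q d c = bilin Q c d.
  rewrite /bilin exchange_big; apply: eq_bigr => i _; apply: eq_bigr => j _.
  by rewrite Qs (mulrC (d j)).
have -> : 2 * r * bilin Q c d = r * bilin Q c d + r * bilin Q d c by rewrite dc; ring.
rewrite /bilin !mulr_sumr -!big_split; apply: eq_bigr => i _ /=.
rewrite !mulr_sumr -!big_split; apply: eq_bigr => j _ /=; ring.
Qed.

Lemma bilin_cauchy_schwarz Q c d : possemidef Q ->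
  bilin Q c d ^+ 2 <= bilin Q c c * bilin Q d d.
Proof.
move=> Qp; apply: discriminant_le => [|r]; first exact: Qp.2.
by rewrite -bilin_expand //; exact: Qp.2.
Qed.

Lemma bilin_deltar Q c j : bilin Q c (fun k => (k == j)%:R) = \sum_i c i * Q i j.
Proof.
apply: eq_bigr => i _; rewrite (bigD1 j) //= eqxx mulr1 big1 ?addr0 // => k /negPf ->.
by rewrite mulr0 mul0r.
Qed.

Lemma bilin_delta Q i j : bilin Q (fun k => (k == i)%:R) (fun k => (k == j)%:R) = Q i j.
Proof.
rewrite bilin_deltar (bigD1 i) //= eqxx mul1r big1 ?addr0 // => k /negPf ->.
by rewrite mul0r.
Qed.

Lemma possemidef_diag Q i : possemidef Q -> 0 <= Q i i.
Proof. by move=> Qp; rewrite -bilin_delta; exact: Qp.2. Qed.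

Lemma possemidef_diag0 Q i j : possemidef Q -> Q i i = 0 -> Q i j = 0.
Proof.
move=> Qp Qi; apply/eqP; rewrite -sqrf_eq0 eq_le sqr_ge0 andbT.
by have := bilin_cauchy_schwarz (fun k => (k == i)%:R) (fun k => (k == j)%:R) Qp;
  rewrite !bilin_delta Qi mul0r.
Qed.

(** The Schur complement of the pivot [k] stays positive by Cauchy-Schwarz against the basis vector
    at [k]. *)
Lemma possemidef_schur Q k : possemidef Q -> Q k k != 0 ->
  possemidef (fun i j => Q i j - Q i k * Q j k / Q k k).
Proof.
move=> Qp Qk0; have Qk : 0 < Q k k by rewrite lt_def Qk0 possemidef_diag.
split=> [i j|c]; first by rewrite Qp.1 (mulrC (Q i k)).
have -> : bilin (fun i j => Q i j - Q i k * Q j k / Q k k) c c =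
    bilin Q c c - (\sum_i c i * Q i k) ^+ 2 / Q k k.
  rewrite /bilin expr2 -mulrA mulr_suml -sumrB; apply: eq_bigr => i _.
  by rewrite mulr_suml mulr_sumr -sumrB; apply: eq_bigr => j _; field.
rewrite subr_ge0 ler_pdivrMr // -bilin_deltar -[in leRHS](bilin_delta Q k k).
exact: bilin_cauchy_schwarz.
Qed.

(** Induction on the number of nonzero diagonal entries: a Schur complement clears its pivot and
    creates no new one. A positive matrix with zero diagonal is zero. *)
Lemma gram_decomposition Q : possemidef Q ->
  exists r : seq (I -> R), forall i j, Q i j = \sum_(v <- r) v i * v j.
Proof.
have [n] := ubnP #|[set i | Q i i != 0]|; elim: n Q => // n IH Q lt Qp.
have [Qd|] := pickP (fun k => Q k k != 0); last first.
  move=> Q0; exists [::] => i j; rewrite big_nil possemidef_diag0 //.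
  by apply/eqP; rewrite -[_ == _]negbK Q0.
move=> Qk; set Q' := fun i j => Q i j - Q i Qd * Q j Qd / Q Qd Qd.
have [|r hr] := IH Q' _ (possemidef_schur Qp Qk).
  rewrite -ltnS; apply: leq_trans lt; rewrite ltnS; apply: proper_card.
  apply/properP; split.
    apply/fintype.subsetP => i; rewrite !inE; apply: contra => /eqP Qi.
    by rewrite /Q' Qi possemidef_diag0 // !mul0r subrr.
  by exists Qd; rewrite !inE // /Q' mulfK // subrr eqxx.
exists ((fun i => Q i Qd / Num.sqrt (Q Qd Qd)) :: r) => i j.
rewrite big_cons -hr /Q' mulrACA -invfM -expr2 sqr_sqrtr ?possemidef_diag //.
by rewrite addrC subrK.
Qed.

End Gram.

(** * The product of two states on the monoid of pairs *)

Section Tensor.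
Variable R : realType.

(** Lists the operations that occur in the definition of a magic unitary. Scalars are left out on
    purpose: the maps built from real states need not be complex linear. *)
Record star_hom (X Y : cstarAlgType R) (h : X -> Y) : Prop := StarHom {
  homD : forall x y, h (x + y) = h x + h y;
  homM : forall x y, h (x * y) = h x * h y;
  hom1 : h 1 = 1;
  homS : forall x, h (star x) = star (h x)
}.

Lemma state_sum (X : cstarAlgType R) (f : X -> R) (I : finType) (F : I -> X) :
  real_state f -> f (\sum_i F i) = \sum_i f (F i).
Proof.
move=> fs; apply: (big_morph f (stateD fs)).
by rewrite -(scale0r 0) (stateZ fs 0) mul0r.
Qed.

Lemma state_form (X : cstarAlgType R) (f : X -> R) (I : finType) (c : I -> R) (a : I -> X) :
  real_state f -> \sum_i \sum_j c i * c j * f (star (a i) * a j) =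
  f (star (\sum_i (c i)%:C *: a i) * (\sum_i (c i)%:C *: a i)).
Proof.
move=> fs; rewrite star_sum mulr_suml state_sum //; apply: eq_bigr => i _.
rewrite mulr_sumr state_sum //; apply: eq_bigr => j _.
by rewrite starZr -scalerAl -scalerAr !(stateZ fs) mulrA.
Qed.

(** [d] is a square root of [cnorm a ^+ 2 - star a * a], so the defect of the contraction is again a
    form of the same shape. *)
Lemma state_contract (X : cstarAlgType R) (f : X -> R) (a : X) : real_state f ->
  exists d : X, forall x y, f (star (d * x) * (d * y)) =
    cnorm a ^+ 2 * f (star x * y) - f (star (a * x) * (a * y)).
Proof.
move=> fs; have as' : star (star a * a) = star a * a by rewrite starM starK.
have [d [ds dE]] := cpos_norm_sub as'; exists d => x y.
rewrite starM ds mulrA -(mulrA (star x)) dE cnorm_starM.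
rewrite mulrBr mulrBl -scalerAr mulr1 -scalerAl (stateD fs) (stateZ fs).
by rewrite -scaleN1r -(rmorphN1 (real_complex R)) (stateZ fs) mulN1r starM !mulrA.
Qed.

Variables (A B : cstarAlgType R) (f : A -> R) (g : B -> R).
Hypotheses (fs : real_state f) (gs : real_state g).

Local Notation M := (A * B)%type.
Definition tmul (x y : M) : M := (x.1 * y.1, x.2 * y.2).
Definition tstar (x : M) : M := (star x.1, star x.2).
Definition tstate (x : M) : R := f x.1 * g x.2.

(** Schur's product theorem: the Gram matrix of [g] is a sum of matrices [v i * v j], and each of
    them leaves a form of [f] alone with coefficients [c i * v i]. *)
Lemma tensor_form_ge0 (I : finType) (c : I -> R) (m : I -> M) :
  0 <= kernel_form tmul tstar tstate c m.
Proof.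
have [|r hr] := @gram_decomposition R I (fun i j => g (star (m i).2 * (m j).2)).
  split=> [i j|d]; first by rewrite -(state_star gs) starM starK.
  by rewrite /bilin (state_form d (fun i => (m i).2) gs); exact: state_ge0.
have -> : kernel_form tmul tstar tstate c m =
    \sum_(v <- r) \sum_i \sum_j (c i * v i) * (c j * v j) * f (star (m i).1 * (m j).1).
  rewrite exchange_big; apply: eq_bigr => i _; rewrite exchange_big.
  apply: eq_bigr => j _; rewrite /tstate /= hr !mulr_sumr.
  by apply: eq_bigr => v _; ring.
apply: sumr_ge0 => v _.
by rewrite (state_form (fun i => c i * v i) (fun i => (m i).1) fs); exact: state_ge0.
Qed.

(** One coordinate at a time: the defect of each inequality is the form of the vectors whose
    coordinate is multiplied by [d] or [e], hence nonnegative. The constant is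
    [cnorm x.1 * cnorm x.2]. *)
Lemma tensor_form_bounded (x : M) : exists C : R, 0 <= C /\
  forall (I : finType) (c : I -> R) m,
    kernel_form tmul tstar tstate c (fun i => tmul x (m i))
      <= C ^+ 2 * kernel_form tmul tstar tstate c m.
Proof.
have [d hd] := state_contract x.1 fs; have [e he] := state_contract x.2 gs.
exists (cnorm x.1 * cnorm x.2); split=> [|I c m].
  by rewrite mulr_ge0 // cnorm_ge0.
have l1 : kernel_form tmul tstar tstate c (fun i => tmul x (m i)) <=
    cnorm x.1 ^+ 2 * kernel_form tmul tstar tstate c (fun i => ((m i).1, x.2 * (m i).2)).
  rewrite -subr_ge0; apply: le_trans (tensor_form_ge0 c (fun i => (d * (m i).1, x.2 * (m i).2))) _.
  rewrite le_eqVlt; apply/orP; left; apply/eqP.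
  rewrite /kernel_form mulr_sumr -sumrB; apply: eq_bigr => i _.
  rewrite mulr_sumr -sumrB; apply: eq_bigr => j _.
  by rewrite /tstate /= hd; ring.
have l2 : kernel_form tmul tstar tstate c (fun i => ((m i).1, x.2 * (m i).2)) <=
    cnorm x.2 ^+ 2 * kernel_form tmul tstar tstate c m.
  rewrite -subr_ge0; apply: le_trans (tensor_form_ge0 c (fun i => ((m i).1, e * (m i).2))) _.
  rewrite le_eqVlt; apply/orP; left; apply/eqP.
  rewrite /kernel_form mulr_sumr -sumrB; apply: eq_bigr => i _.
  rewrite mulr_sumr -sumrB; apply: eq_bigr => j _.
  by rewrite /tstate /= he; ring.
apply: le_trans l1 _; rewrite exprMn -(mulrA (cnorm x.1 ^+ 2)).
exact: ler_wpM2l (sqr_ge0 _) _ _ l2.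
Qed.

(** The maps are [a |-> (a, 1)] and [b |-> (1, b)]. The monoid has no addition; additivity comes
    from the last clause of [monoid_cstar], as [tstate] is additive in each coordinate. *)
Lemma tensor_of_states : exists (X : cstarAlgType R) (h : A -> X) (k : B -> X),
  star_hom h /\ star_hom k.
Proof.
have [|||||||X [F [F1 FM FS FD]]] := @monoid_cstar R M (1, 1) tmul tstar _ _ _ _ _
  tstate _ _ tensor_form_ge0 tensor_form_bounded.
- by move=> x y z; rewrite /tmul !mulrA.
- by case=> a b; rewrite /tmul !mul1r.
- by case=> a b; rewrite /tmul !mulr1.
- by case=> a b; rewrite /tstar !starK.
- by move=> x y; rewrite /tmul /tstar !starM.
- by rewrite /tstate (state1 fs) (state1 gs) mulr1.
- by move=> x; rewrite /tstate (state_star fs) (state_star gs).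
exists X, (fun a => F (a, 1)), (fun b => F (1, b)); split; split.
- by move=> a a'; apply: FD => u v; rewrite /tstate /= mulrDl mulrDr (stateD fs) mulrDl.
- by move=> a a'; rewrite -FM /tmul /= mulr1.
- exact: F1.
- by move=> a; rewrite -FS /tstar /= star1.
- by move=> b b'; apply: FD => u v; rewrite /tstate /= mulrDl mulrDr (stateD gs) mulrDr.
- by move=> b b'; rewrite -FM /tmul /= mulr1.
- exact: F1.
- by move=> b; rewrite -FS /tstar /= star1.
Qed.

End Tensor.

Lemma tensor (R : realType) (A B : cstarAlgType R) :
  exists (X : cstarAlgType R) (h : A -> X) (k : B -> X), star_hom h /\ star_hom k.
Proof.
have [[f fs] [g gs]] := (exists_real_state A, exists_real_state B).
exact: tensor_of_states fs gs.
Qed.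

Lemma star_hom_id (R : realType) (A : cstarAlgType R) : star_hom (@id A).
Proof. by []. Qed.

Lemma star_hom_comp (R : realType) (A B C : cstarAlgType R) (h : A -> B) (k : B -> C) :
  star_hom h -> star_hom k -> star_hom (k \o h).
Proof.
move=> hh kh; split=> [x y|x y||x] /=.
- by rewrite (homD hh) (homD kh).
- by rewrite (homM hh) (homM kh).
- by rewrite (hom1 hh) (hom1 kh).
- by rewrite (homS hh) (homS kh).
Qed.

Lemma common_cstar (R : realType) (n : nat) (Xs : 'I_n.+1 -> cstarAlgType R) :
  exists X : cstarAlgType R, forall i, exists h : Xs i -> X, star_hom h.
Proof.
elim: n Xs => [|n IH] Xs.
  by exists (Xs ord0) => i; rewrite (ord1 i); exists id; exact: star_hom_id.
have [Y hY] := IH (fun i => Xs (lift ord0 i)).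
have [X [h [k [hh kh]]]] := tensor (Xs ord0) Y.
exists X => i; have [j ->|->] := unliftP ord0 i; last by exists h.
by have [l lh] := hY j; exists (k \o l); exact: star_hom_comp.
Qed.

(** * Hall's theorem *)

Section Hall.
Variables (I J : finType).
Implicit Types (S : I -> {set J}) (A B : {set I}).

Definition nbrs S A := \bigcup_(i in A) S i.
Definition hall S := forall A, (#|A| <= #|nbrs S A|)%N.

Definition shrink S i x : I -> {set J} := fun k => if k == i then S i :\ x else S k.

Lemma nbrs_eq S S' A : {in A, S =1 S'} -> nbrs S A = nbrs S' A.
Proof. by move=> h; apply: eq_bigr. Qed.

Lemma nbrs_setU S A B : nbrs S (A :|: B) = nbrs S A :|: nbrs S B.
Proof. by rewrite /nbrs finset.bigcup_setU. Qed.

Lemma nbrs_sub S A B : A \subset B -> nbrs S A \subset nbrs S B.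
Proof. by move=> /finset.setUidPr <-; rewrite nbrs_setU finset.subsetUl. Qed.

Lemma nbrs_shrink S i x A : i \notin A -> nbrs (shrink S i x) A = nbrs S A.
Proof.
move=> iA; apply: nbrs_eq => k kA; rewrite /shrink; case: eqP => // ki.
by rewrite -ki kA in iA.
Qed.

(* A set violating Hall's condition after the shrinking contains i; A is that
   set without i. *)
Lemma not_hall_shrink S i x : hall S -> ~ hall (shrink S i x) ->
  exists A, i \notin A /\ (#|nbrs S A :|: (S i :\ x)| <= #|A|)%N.
Proof.
move=> hS /existsNP [A0 /negP]; rewrite -ltnNge => lt0.
have iA : i \in A0.
  apply/negP => /negP iA; move: lt0; rewrite nbrs_shrink // ltnNge.
  by rewrite hS.
exists (A0 :\ i); split; first by rewrite !inE eqxx.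
rewrite -ltnS -[X in (_ < X)%N]add1n.
have -> : (1 + #|A0 :\ i|)%N = #|A0| by rewrite (cardsD1 i A0) iA.
apply: leq_ltn_trans lt0; rewrite -[in X in (_ <= X)%N](finset.setD1K iA) nbrs_setU.
rewrite (@nbrs_shrink S i x (A0 :\ i)) ?inE ?eqxx //.
by rewrite {2}/nbrs big_set1 /shrink eqxx finset.setUC.
Qed.

(** Rado's argument. If both shrinkings fail, with sets [A] and [B], the two small sets of
    [not_hall_shrink] have a union containing the neighbours of [A], [B] and [i], because [x != y],
    and an intersection containing those of [A :&: B]. Counting gives
    [#|A| + #|B| + 1 <= #|A| + #|B|]. *)
Lemma hall_shrink S i x y : hall S -> x != y ->
  hall (shrink S i x) \/ hall (shrink S i y).
Proof.
move=> hS xy; have [?|/(not_hall_shrink hS) [A [iA lA]]] := pselect (hall (shrink S i x)).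
  by left.
have [?|/(not_hall_shrink hS) [B [iB lB]]] := pselect (hall (shrink S i y)).
  by right.
have h1 := hS (i |: (A :|: B)); have h2 := hS (A :&: B).
have iAB : i \notin A :|: B by rewrite inE negb_or iA iB.
rewrite cardsU1 iAB /= nbrs_setU {1}/nbrs big_set1 nbrs_setU in h1.
have s1 : S i :|: (nbrs S A :|: nbrs S B) \subset
    (nbrs S A :|: (S i :\ x)) :|: (nbrs S B :|: (S i :\ y)).
  apply/fintype.subsetP => z; rewrite !inE; have [->|zx] := eqVneq z x.
    by rewrite xy /=; case: (x \in S i); rewrite ?orbT //= => /orP [] ->; rewrite ?orbT.
  by case/or3P => -> /=; rewrite ?orbT.
have s2 : nbrs S (A :&: B) \subset (nbrs S A :|: (S i :\ x)) :&: (nbrs S B :|: (S i :\ y)).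
  rewrite finset.subsetI; apply/andP; split.
    by apply: fintype.subset_trans (nbrs_sub _ (finset.subsetIl A B)) (finset.subsetUl _ _).
  by apply: fintype.subset_trans (nbrs_sub _ (finset.subsetIr A B)) (finset.subsetUl _ _).
have := cardsUI (nbrs S A :|: (S i :\ x)) (nbrs S B :|: (S i :\ y)).
have := cardsUI A B.
move: (subset_leq_card s1) (subset_leq_card s2) h1 h2 lA lB; lia.
Qed.

(** Shrinking a set with two elements lowers the total size, so all sets may be taken to be
    singletons; Hall's condition on pairs then yields injectivity. *)
Lemma hall_marriage S : hall S -> exists f : I -> J, injective f /\ forall i, f i \in S i.
Proof.
have [n] := ubnP (\sum_i #|S i|)%N; elim: n S => // n IH S lt hS.
have [i big|small] := pickP (fun i => (1 < #|S i|)%N).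
  have /card_gt1P [x [y [xS yS xy]]] := big.
  have step z : z \in S i -> hall (shrink S i z) ->
      exists f : I -> J, injective f /\ forall i, f i \in S i.
    move=> zS hz; have [|f [fi fS]] := IH _ _ hz.
      rewrite -ltnS; apply: leq_trans lt; rewrite ltnS.
      rewrite (bigD1 i) // [in X in (_ < X)%N](bigD1 i) //= -addSn leq_add //.
        by rewrite /shrink eqxx [in X in (_ <= X)%N](cardsD1 z) zS.
      by apply: leq_sum => k /negPf ki; rewrite /shrink ki.
    exists f; split=> // k; have := fS k; rewrite /shrink; case: eqP => [->|//].
    by rewrite inE => /andP [].
  by have [] := hall_shrink i hS xy; apply: step.
have ne i : exists z, z \in S i.
  apply/set0Pn; rewrite -card_gt0; have := hS [set i].
  by rewrite cards1 /nbrs big_set1.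
have [f fS] := choice ne; exists f; split=> // i j fij; apply/eqP/negPn/negP => ij.
have := hS [set i; j]; rewrite cards2 ij /nbrs finset.bigcup_setU !big_set1.
have sub k : S k \subset [set f k].
  apply/fintype.subsetP => z zS; rewrite inE; apply/negPn/negP => zf.
  have := small k; rewrite ltnNge => /negbFE; rewrite leqNgt => /negP; apply.
  by apply/card_gt1P; exists z, (f k).
have := sub i; have := sub j; rewrite fij => sj si.
have : (#|S i :|: S j| <= 1)%N.
  by rewrite -(cards1 (f j)) subset_leq_card // finset.subUset si sj.
by rewrite leqNgt => /negP h /h.
Qed.

End Hall.

(** The columns in [A] carry mass [#|A|], all of it in the rows of [nbrs S A], each of total mass
    [1]; this is Hall's condition. *)
Lemma doubly_stochastic_perm (R : realFieldType) (n : nat) (D : 'I_n -> 'I_n -> R) :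
  (forall j i, 0 <= D j i) -> (forall j, \sum_i D j i = 1) ->
  (forall i, \sum_j D j i = 1) -> exists s : 'S_n, forall i, 0 < D (s i) i.
Proof.
move=> D0 D1 D2; pose S i : {set 'I_n} := [set j | 0 < D j i].
have [A|f [fi fS]] := @hall_marriage _ _ S; last first.
  by exists (perm fi) => i; rewrite permE; have := fS i; rewrite inE.
rewrite -(ler_nat R) -[X in X%:R <= _]sum1_card -[X in _ <= X%:R]sum1_card !natr_sum.
have -> : \sum_(i in A) 1%:R = \sum_(i in A) \sum_(j in nbrs S A) D j i.
  apply: eq_bigr => i iA; rewrite -[LHS](D2 i) [LHS](bigID [in nbrs S A]) /=.
  rewrite [X in _ + X]big1 ?addr0 // => j jN.
  apply/eqP; rewrite eq_le D0 andbT leNgt; apply: contra jN => ji.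
  by apply/bigcupP; exists i; rewrite ?inE.
rewrite exchange_big /=; apply: ler_sum => j _; rewrite -(D1 j).
by rewrite [leRHS](bigID [in A]) /= lerDl sumr_ge0.
Qed.

(** * Quantum isomorphisms *)

Section Projections.
Variables (R : realType) (X : cstarAlgType R).

Lemma cpos_sum (I : Type) (r : seq I) (P : pred I) (F : I -> X) :
  (forall i, P i -> cpos (F i)) -> cpos (\sum_(i <- r | P i) F i).
Proof. by move=> FP; apply: big_ind => //; [exact: cpos0 | exact: cposD]. Qed.

(** Compressing the sum by [F j] leaves a vanishing sum of the positive elements
    [star (F k * F j) * (F k * F j)] with [k != j], so each of them is zero by [cpos_add_eq0]. *)
Lemma projections_orthogonal (I : finType) (F : I -> X) i j :
  (forall k, is_projection (F k)) -> \sum_k F k = 1 -> i != j -> F i * F j = 0.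
Proof.
move=> Fp F1 ij; have [js jj] := Fp j.
have sumj : \sum_(k | k != j) F j * F k * F j = 0.
  have e : \sum_k F j * F k * F j = F j.
    by rewrite -mulr_suml -mulr_sumr F1 mulr1.
  move: e; rewrite (bigD1 j) //= !jj => /(canRL (addKr _)) ->.
  by rewrite addNr.
have pk k : cpos (F j * F k * F j).
  have [ks kk] := Fp k.
  have -> : F j * F k * F j = star (F k * F j) * (F k * F j).
    by rewrite starM ks js mulrA -(mulrA (F j) (F k) (F k)) kk.
  exact: cpos_star_mul.
move: sumj; rewrite (bigD1 i) //= => /(cpos_add_eq0 (pk i) (cpos_sum _ (fun k _ => pk k))) h.
apply: star_mul_eq0.
have [is' ii] := Fp i.
by rewrite starM is' js mulrA -(mulrA (F j)) ii.
Qed.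

Lemma projection_sum (I : finType) (P : pred I) (F : I -> X) :
  (forall k, is_projection (F k)) -> \sum_k F k = 1 ->
  is_projection (\sum_(k | P k) F k).
Proof.
move=> Fp F1; split; first by rewrite star_sum; apply: eq_bigr => k _; case: (Fp k).
rewrite mulr_suml; apply: eq_bigr => i Pi; rewrite mulr_sumr (bigD1 i) //=.
rewrite big1 ?addr0; first by case: (Fp i).
by move=> k /andP [_ ki]; apply: projections_orthogonal => //; rewrite eq_sym.
Qed.

Lemma scale1_eq0 (a : R[i]) (x : X) : a *: x = 0 -> x != 0 -> a = 0.
Proof.
move=> ax x0; apply/eqP/negPn/negP => a0; move/eqP: x0; apply.
by rewrite -(scale1r x) -(mulVf a0) -scalerA ax scaler0.
Qed.

Lemma natr_inj (m n : nat) : m%:R = n%:R :> X -> m = n.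
Proof.
rewrite -(scaler_nat m (1 : X)) -(scaler_nat n (1 : X)) => /eqP.
rewrite -subr_eq0 -scalerBl => /eqP /scale1_eq0 /(_ (oner_neq0 _)) /eqP.
by rewrite subr_eq0 eqr_nat => /eqP.
Qed.

(** [p = c *: q] with [c = n / m]; idempotency gives [c^2 = c] unless [q = 0], and [c] is
    nonzero. *)
Lemma projection_proportional (p q : X) (m n : nat) : (0 < m)%N -> (0 < n)%N ->
  is_projection p -> is_projection q -> p *+ m = q *+ n -> p = q.
Proof.
move=> m0 n0 [_ pp] [_ qq] e.
have m0' : (m%:R : R[i]) != 0 by rewrite pnatr_eq0 -lt0n.
have n0' : (n%:R : R[i]) != 0 by rewrite pnatr_eq0 -lt0n.
pose c : R[i] := n%:R / m%:R.
have pE : p = c *: q.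
  by rewrite /c mulrC -scalerA scaler_nat -e -(scaler_nat m p) scalerA mulVf ?scale1r.
have [q0|q0] := eqVneq q 0; first by rewrite pE q0 scaler0.
have : (c * c - c) *: q = 0.
  have e2 : (c * c) *: q = p by rewrite -[RHS]pp pE -(scalerAl c q) -(scalerAr c q q) qq scalerA.
  by rewrite scalerBl e2 -pE subrr.
move/scale1_eq0 => /(_ q0) /eqP; rewrite -{3}(mulr1 c) -mulrBr mulf_eq0.
have c0 : c != 0 by rewrite mulf_neq0 ?invr_eq0.
by rewrite (negPf c0) subr_eq0 /= => /eqP c1; rewrite pE c1 scale1r.
Qed.

End Projections.

(** * Magic unitaries indexed by vertices *)

Section QuantumMatrix.
Variable R : realType.

(** Indexing by the vertices themselves makes blocks and reindexing direct; [qm_adj] is the entry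
    [(b, a)] of the intertwining equation, with rows in [T]. *)
Record quantum_matrix (X : cstarAlgType R) (S T : finType) (eS : rel S) (eT : rel T)
    (u : T -> S -> X) : Prop := QuantumMatrix {
  qm_proj : forall b a, is_projection (u b a);
  qm_row : forall b, \sum_a u b a = 1;
  qm_col : forall a, \sum_b u b a = 1;
  qm_adj : forall b a, \sum_(a' | eS a' a) u b a' = \sum_(b' | eT b b') u b' a
}.

Lemma qm_sym (X : cstarAlgType R) (S T : finType) (eS : rel S) (eT : rel T)
    (u : T -> S -> X) : symmetric eS -> symmetric eT -> quantum_matrix eS eT u ->
  quantum_matrix eT eS (fun a b => u b a).
Proof.
move=> sS sT [up ur uc ua]; split=> // a b.
rewrite (eq_bigl (fun b' => eT b b')); last by move=> b'; rewrite sT.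
by rewrite -ua; apply: eq_bigl => a'; rewrite sS.
Qed.

Lemma qm_transfer (X : cstarAlgType R) (S T S' T' : finType) (eS : rel S) (eT : rel T)
    (eS' : rel S') (eT' : rel T') (f : S' -> S) (g : T' -> T) (u : T -> S -> X) :
  bijective f -> bijective g -> (forall x y, eS (f x) (f y) = eS' x y) ->
  (forall x y, eT (g x) (g y) = eT' x y) ->
  quantum_matrix eS eT u -> quantum_matrix eS' eT' (fun b a => u (g b) (f a)).
Proof.
move=> bf bg ef eg [up ur uc ua]; split=> [b a|b|a|b a]; first exact: up.
- by rewrite -(ur (g b)) [RHS](reindex f) //; exact: onW_bij.
- by rewrite -(uc (f a)) [RHS](reindex g) //; exact: onW_bij.
have := ua (g b) (f a); rewrite (reindex f); last exact: onW_bij.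
rewrite [in RHS](reindex g); last exact: onW_bij.
under eq_bigl do rewrite ef.
by under [in RHS]eq_bigl do rewrite eg.
Qed.

Lemma qm_card (X : cstarAlgType R) (S T : finType) (u : T -> S -> X) :
  (forall b, \sum_a u b a = 1) -> (forall a, \sum_b u b a = 1) -> #|S| = #|T|.
Proof.
move=> ur uc; apply: (@natr_inj R X).
have card (I : finType) : #|I|%:R = \sum_(i : I) 1 :> X by rewrite sumr_const.
rewrite !card; transitivity (\sum_a \sum_b u b a); first exact: eq_bigr.
by rewrite exchange_big; exact: eq_bigr.
Qed.

Lemma qm_quantum_isomorphic (X : cstarAlgType R) (G H : graph) (u : H -> G -> X) :
  quantum_matrix (@adj G) (@adj H) u -> quantum_isomorphic R G H.
Proof.
move=> uq; have GH : #|G| = #|H| by apply: qm_card (qm_row uq) (qm_col uq).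
have bG := onW_bij predT (@enum_val_bij G); have bH := onW_bij predT (@enum_val_bij H).
split=> //; exists X, (\matrix_(i, j) u (enum_val i) (enum_val j)); split.
  split=> [|i j|i|j]; first exact: esym GH.
  - by rewrite mxE; exact: qm_proj uq _ _.
  - rewrite -(qm_row uq (enum_val i)) [RHS](reindex _ bG).
    by apply: eq_bigr => j _; rewrite mxE.
  - rewrite -(qm_col uq (enum_val j)) [RHS](reindex _ bH).
    by apply: eq_bigr => i _; rewrite mxE.
apply/matrixP => i j; rewrite !mxE.
have := qm_adj uq (enum_val i) (enum_val j).
rewrite big_mkcond [RHS]big_mkcond (reindex _ bG) [RHS](reindex _ bH) /= => e.
etransitivity; [|etransitivity; [exact: e|]]; apply: eq_bigr => k _; rewrite !mxE.
  by case: adj; rewrite ?mulr1 ?mulr0.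
by case: adj; rewrite ?mul1r ?mul0r.
Qed.

Lemma quantum_isomorphic_qm (G H : graph) : quantum_isomorphic R G H ->
  exists (X : cstarAlgType R) (u : H -> G -> X), quantum_matrix (@adj G) (@adj H) u.
Proof.
case=> GH [X [U [[_ Up Ur Uc] UA]]].
have bG := onW_bij predT (@enum_rank_bij G); have bH := onW_bij predT (@enum_rank_bij H).
exists X, (fun h g => U (enum_rank h) (enum_rank g)); split=> [b a|b|a|b a].
- exact: Up.
- by rewrite -(Ur (enum_rank b)) [RHS](reindex _ bG).
- by rewrite -(Uc (enum_rank a)) [RHS](reindex _ bH).
have /matrixP /(_ (enum_rank b) (enum_rank a)) := UA.
rewrite /= !mxE (reindex _ bG) [RHS](reindex _ bH) /= => e.
rewrite big_mkcond [RHS]big_mkcond.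
etransitivity; [|etransitivity; [exact: e|]]; apply: eq_bigr => k _.
  by rewrite !mxE !enum_rankK; case: adj; rewrite ?mulr1 ?mulr0.
by rewrite !mxE !enum_rankK; case: adj; rewrite ?mul1r ?mul0r.
Qed.

Lemma qm_hom (X Y : cstarAlgType R) (h : X -> Y) (S T : finType) (eS : rel S)
    (eT : rel T) (u : T -> S -> X) : star_hom h ->
  quantum_matrix eS eT u -> quantum_matrix eS eT (fun b a => h (u b a)).
Proof.
move=> hh [up ur uc ua].
have h0 : h 0 = 0 by apply: (addIr (h 0)); rewrite -(homD hh) !add0r.
have hsum (I : finType) (P : pred I) F : h (\sum_(i | P i) F i) = \sum_(i | P i) h (F i).
  exact: (big_morph h (homD hh) h0).
split=> [b a|b|a|b a].
- by have [ps pp] := up b a; split; [rewrite -(homS hh) ps | rewrite -(homM hh) pp].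
- by rewrite -hsum ur (hom1 hh).
- by rewrite -hsum uc (hom1 hh).
by rewrite -!hsum ua.
Qed.

(* The corner p X p is already complete: passing to its completion only
   packages it as a C*-algebra with unit p. *)
Lemma corner_hom (X : cstarAlgType R) (p : X) : is_projection p -> p != 0 ->
  exists (Y : cstarAlgType R) (f : X -> Y), let dom x := p * x = x /\ x * p = x in
  [/\ forall x y, dom x -> dom y -> f (x + y) = f x + f y,
      forall x y, dom x -> dom y -> f (x * y) = f x * f y,
      f p = 1 & forall x, dom x -> f (star x) = star (f x)].
Proof.
move=> [ps pp] p0; pose dom x := p * x = x /\ x * p = x.
have d1 : dom p by [].
have dD x y : dom x -> dom y -> dom (x + y).
  by move=> [h1 h2] [h3 h4]; rewrite /dom mulrDr mulrDl h1 h2 h3 h4.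
have dZ (a : R[i]) x : dom x -> dom (a *: x).
  by move=> [h1 h2]; rewrite /dom -scalerAr -scalerAl h1 h2.
have dM x y : dom x -> dom y -> dom (x * y).
  by move=> [h1 h2] [h3 h4]; rewrite /dom mulrA h1 -mulrA h4.
have dS x : dom x -> dom (star x).
  by move=> [h1 h2]; split; rewrite -{1}ps -starM ?h1 ?h2.
pose A := @PreStar R X dom p *%R (@star R X) d1 dD dZ dM dS
  (fun x y z _ _ _ => mulrA x y z) (fun x dx => dx.1) (fun x dx => dx.2)
  (fun x y z _ _ _ => mulrDl x y z) (fun x y z _ _ _ => mulrDr x y z)
  (fun a x y _ _ => esym (scalerAl a x y)) (fun a x y _ _ => esym (scalerAr a x y))
  (fun x _ => starK x) (fun x y _ _ => starD x y) (fun a x _ => starZ a x)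
  (fun x y _ _ => starM x y).
have n1 : cnorm p != 0 by apply: contra p0 => /eqP /cnorm_eq0 ->.
pose B := @PreCStar R X A (@cnorm R X) (fun x _ => cnorm_ge0 x)
  (fun x y _ _ => cnormD_le x y) (fun a x _ => cnormZ a x)
  (fun x y _ _ => cnormM_le x y) (fun x _ => cnorm_starM x) n1.
have [Y [f [fD fM f1 fS _]]] := preCStar_completion B.
by exists Y, f.
Qed.

End QuantumMatrix.

(** * Blocks indexed by connected components *)

Section Components.
Variable R : realType.

Lemma sum_tagged (V : nmodType) (n : nat) (Gs : 'I_n -> graph)
    (P : pred {i & Gs i}) (F : {i & Gs i} -> V) :
  \sum_(p | P p) F p = \sum_i \sum_(a : Gs i | P (Tagged Gs a)) F (Tagged Gs a).
Proof.
rewrite (@sig_big_dep _ _ _ _ (fun i => Gs i : finType) predT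
  (fun i a => P (Tagged Gs a)) (fun i a => F (Tagged Gs a))) /=.
by apply: eq_big => [[i a]|[i a]].
Qed.

Lemma sum_adj_tagged (n : nat) (Gs : 'I_n -> graph) i (a a' : Gs i) :
  sum_adj (Tagged Gs a) (Tagged Gs a') = adj a a'.
Proof. by rewrite /sum_adj /= eqxx tagged_asE. Qed.

Lemma sum_adj_sym (n : nat) (Gs : 'I_n -> graph) : symmetric (@sum_adj n Gs).
Proof.
move=> [i a] [j b]; have [ij|ij] := eqVneq i j.
  by case: _ / ij b => b; rewrite !sum_adj_tagged adj_sym.
by rewrite /sum_adj /= (negPf ij) eq_sym (negPf ij).
Qed.

(** Multiply the intertwining relation at [(b, a')] by [u b a] on the left and [u b' a'] on the
    right. Row orthogonality kills the left sum, as [a] is not adjacent to [a']; column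
    orthogonality leaves only [b'] in the right one. *)
Lemma qm_orthogonal (X : cstarAlgType R) (S T : finType) (eS : rel S) (eT : rel T)
    (u : T -> S -> X) b b' a a' : quantum_matrix eS eT u ->
  eT b b' -> ~~ eS a a' -> u b a * u b' a' = 0.
Proof.
move=> [up ur uc ua] bb aa.
have row x : x != a -> u b a * u b x = 0.
  by move=> xa; apply: projections_orthogonal (up b) (ur b) _; rewrite eq_sym.
have col y : y != b' -> u y a' * u b' a' = 0.
  exact: projections_orthogonal (fun y => up y a') (uc a').
have := congr1 (fun z => u b a * z * u b' a') (ua b a').
rewrite /= mulr_sumr big1 ?mul0r => [|x xa]; last first.
  by apply: row; apply: contraNneq aa => <-.
rewrite mulr_sumr mulr_suml (bigD1 b') //= big1 ?addr0 => [|y /andP [_ yb]]; last first.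
  by rewrite -mulrA col // mulr0.
by rewrite -mulrA (up b' a').2 => <-.
Qed.

Definition comp_row (X : cstarAlgType R) (n : nat) (Gs : 'I_n -> graph) (T : finType)
  (u : T -> {i & Gs i} -> X) (b : T) (i : 'I_n) : X := \sum_(a : Gs i) u b (Tagged Gs a).

Lemma comp_row_sum (X : cstarAlgType R) (n : nat) (Gs : 'I_n -> graph) (T : finType)
    (eT : rel T) (u : T -> {i & Gs i} -> X) b :
  quantum_matrix (@sum_adj n Gs) eT u -> \sum_i comp_row u b i = 1.
Proof. by move=> uq; rewrite -(qm_row uq b) sum_tagged. Qed.

Lemma comp_row_proj (X : cstarAlgType R) (n : nat) (Gs : 'I_n -> graph) (T : finType)
    (eT : rel T) (u : T -> {i & Gs i} -> X) b i :
  quantum_matrix (@sum_adj n Gs) eT u -> is_projection (comp_row u b i).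
Proof.
move=> uq; have := projection_sum (fun p => tag p == i) (qm_proj uq b) (qm_row uq b).
rewrite sum_tagged (bigD1 i) //= [X in _ + X]big1 ?addr0 => [|j ji]; last first.
  by apply: big_pred0 => a; apply/negbTE.
by under eq_bigl do rewrite eqxx.
Qed.

(** No edge joins distinct components, so [comp_row u b j * comp_row u b' j' = 0] for [j != j'].
    Both families sum to [1], hence each of the two projections equals their product. *)
Lemma comp_row_adj (X : cstarAlgType R) (n : nat) (Gs : 'I_n -> graph) (T : finType)
    (eT : rel T) (u : T -> {i & Gs i} -> X) b b' i :
  quantum_matrix (@sum_adj n Gs) eT u -> eT b b' -> comp_row u b i = comp_row u b' i.
Proof.
move=> uq bb.
have orth j j' : j != j' -> comp_row u b j * comp_row u b' j' = 0.
  move=> jj; rewrite mulr_suml big1 // => a _; rewrite mulr_sumr big1 // => a' _.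
  by apply: qm_orthogonal uq bb _; rewrite /sum_adj /= (negPf jj).
transitivity (comp_row u b i * comp_row u b' i).
  rewrite -[LHS]mulr1 -(comp_row_sum b' uq) mulr_sumr (bigD1 i) //= big1 ?addr0 //.
  by move=> j ji; rewrite orth // eq_sym.
rewrite -[RHS]mul1r -(comp_row_sum b uq) [RHS]mulr_suml [RHS](bigD1 i) //= big1 ?addr0 //.
by move=> j ji; rewrite orth.
Qed.

Lemma comp_row_const (X : cstarAlgType R) (n m : nat) (Gs : 'I_n -> graph)
    (Hs : 'I_m -> graph) (u : {j & Hs j} -> {i & Gs i} -> X) j (b b' : Hs j) i :
  quantum_matrix (@sum_adj n Gs) (@sum_adj m Hs) u -> connected_graph (Hs j) ->
  comp_row u (Tagged Hs b) i = comp_row u (Tagged Hs b') i.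
Proof.
move=> uq /(_ b b') /connectP [p + ->]; elim: p b => //= c p IH b /andP [bc /IH <-].
by apply: comp_row_adj uq _; rewrite sum_adj_tagged.
Qed.

(** * From a quantum isomorphism to its blocks *)

Section Forward.
Variables (X : cstarAlgType R) (k l : nat) (Gs : 'I_k -> graph) (Hs : 'I_l -> graph).
Variable u : {j & Hs j} -> {i & Gs i} -> X.
Hypothesis uq : quantum_matrix (@sum_adj k Gs) (@sum_adj l Hs) u.
Hypotheses (cG : forall i, connected_graph (Gs i)) (cH : forall j, connected_graph (Hs j)).

Let uqT := qm_sym (@sum_adj_sym k Gs) (@sum_adj_sym l Hs) uq.

(* Summing the block (j, i) of u over all of its entries gives both
   |Hs j| * (row sum) and |Gs i| * (column sum). *)
Lemma comp_row_col j i (b : Hs j) (a : Gs i) :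
  comp_row u (Tagged Hs b) i = comp_row (fun x y => u y x) (Tagged Gs a) j.
Proof.
apply: (@projection_proportional _ _ _ _ #|Hs j| #|Gs i|) => //.
- exact: vertex_gt0.
- exact: vertex_gt0.
- exact: comp_row_proj uq.
- exact: comp_row_proj uqT.
transitivity (\sum_(b' : Hs j) comp_row u (Tagged Hs b') i).
  rewrite -sumr_const; apply: eq_bigr => b' _.
  exact: (comp_row_const b b' i uq (@cH j)).
rewrite exchange_big -sumr_const; apply: eq_bigr => a' _.
exact: (comp_row_const a' a j uqT (@cG i)).
Qed.

(** All rows and columns of the block sum to [p], the unit of the corner; an entry lies in the
    corner because it is one of the orthogonal summands of a row. *)
Lemma block_quantum_isomorphic j i (b : Hs j) :
  comp_row u (Tagged Hs b) i != 0 -> quantum_isomorphic R (Gs i) (Hs j).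
Proof.
set p := comp_row _ _ _ => p0.
have pp : is_projection p by exact: comp_row_proj uq.
have [Y [f [fD fM f1 fS]]] := corner_hom pp p0.
have domu (b' : Hs j) (a' : Gs i) :
    p * u (Tagged Hs b') (Tagged Gs a') = u (Tagged Hs b') (Tagged Gs a') /\
    u (Tagged Hs b') (Tagged Gs a') * p = u (Tagged Hs b') (Tagged Gs a').
  have [_ uu] := qm_proj uq (Tagged Hs b') (Tagged Gs a').
  have orth x y : x != y -> u (Tagged Hs b') x * u (Tagged Hs b') y = 0.
    exact: projections_orthogonal (qm_proj uq _) (qm_row uq _).
  have ne (x : Gs i) : x != a' -> Tagged Gs x != Tagged Gs a'.
    by apply: contraNneq => /eqP; rewrite eq_Tagged.
  rewrite /p (comp_row_const b b' i uq (@cH j)); split.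
    rewrite mulr_suml (bigD1 a') //= uu big1 ?addr0 // => x xa.
    by apply: orth; exact: ne.
  rewrite mulr_sumr (bigD1 a') //= uu big1 ?addr0 // => x xa.
  by apply: orth; rewrite eq_sym; exact: ne.
pose dom x := p * x = x /\ x * p = x.
have d0 : dom 0 by rewrite /dom mulr0 mul0r.
have dD x y : dom x -> dom y -> dom (x + y).
  by move=> [h1 h2] [h3 h4]; rewrite /dom mulrDr mulrDl h1 h2 h3 h4.
have f0 : f 0 = 0 by apply: (addIr (f 0)); rewrite -fD // !add0r.
have fsum (I : finType) (P : pred I) (F : I -> X) : (forall z, dom (F z)) ->
    f (\sum_(z | P z) F z) = \sum_(z | P z) f (F z).
  move=> dF; suff [] : dom (\sum_(z | P z) F z) /\
      f (\sum_(z | P z) F z) = \sum_(z | P z) f (F z) by [].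
  apply: (big_ind2 (fun x y => dom x /\ f x = y)) => //.
  by move=> x _ y _ [dx <-] [dy <-]; split; [exact: dD | rewrite fD].
apply: (@qm_quantum_isomorphic _ Y _ _ (fun b' a' => f (u (Tagged Hs b') (Tagged Gs a')))).
split=> [b' a'|b'|a'|b' a'].
- have [us uu] := qm_proj uq (Tagged Hs b') (Tagged Gs a').
  by split; [rewrite -fS ?us | rewrite -fM ?uu].
- rewrite -fsum => [|a']; last exact: domu.
  by rewrite -f1; congr f; exact: (comp_row_const b' b i uq (@cH j)).
- rewrite -fsum => [|b']; last exact: domu.
  by rewrite -f1; congr f; exact: (esym (comp_row_col b a')).
rewrite -fsum => [|x]; last exact: domu.
rewrite -fsum => [|x]; last exact: domu.
congr f.
(* No edge leaves a component, so both sums reduce to vertices of this block. *)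
have := qm_adj uq (Tagged Hs b') (Tagged Gs a'); rewrite !sum_tagged.
rewrite (bigD1 i) //= [X in _ + X]big1 => [|i' ii]; last first.
  by apply: big_pred0 => x; rewrite /sum_adj /= (negPf ii).
rewrite [in RHS](bigD1 j) //= [X in _ = _ + X]big1 => [|j' jj]; last first.
  by apply: big_pred0 => x; rewrite /sum_adj /= eq_sym (negPf jj).
rewrite !addr0.
under eq_bigl do rewrite sum_adj_tagged.
by under [in RHS]eq_bigl do rewrite sum_adj_tagged.
Qed.

Definition some_vertex (G : graph) : G := enum_val (Ordinal (vertex_gt0 G)).

Lemma matching_components : exists (kl : k = l) (s : 'S_k),
  forall i : 'I_k, quantum_isomorphic R (Gs i) (Hs (cast_ord kl (s i))).
Proof.
pose p j i := comp_row u (Tagged Hs (some_vertex (Hs j))) i.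
have p_row j : \sum_i p j i = 1 by exact: comp_row_sum uq.
have p_col i : \sum_j p j i = 1.
  rewrite -(comp_row_sum (Tagged Gs (some_vertex (Gs i))) uqT).
  by apply: eq_bigr => j _; exact: comp_row_col.
have kl : k = l by have := qm_card p_row p_col; rewrite !card_ord.
exists kl; have [f fs] := exists_real_state X.
have f0 : f 0 = 0 by rewrite -(scale0r 0) (stateZ fs 0) mul0r.
have [|||s hs] := @doubly_stochastic_perm R k (fun j i => f (p (cast_ord kl j) i)).
- move=> j i; have [ps pp] : is_projection (p (cast_ord kl j) i) by exact: comp_row_proj uq.
  by rewrite -pp -{1}ps; exact: state_ge0.
- by move=> j; rewrite -(state_sum _ fs) p_row (state1 fs).
- move=> i; rewrite -(state_sum _ fs) -(state1 fs) -(p_col i); congr f.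
  rewrite [RHS](reindex (cast_ord kl)) //; apply: onW_bij.
  by exists (cast_ord (esym kl)) => x; rewrite ?cast_ordK ?cast_ordKV.
exists s => i; apply: (@block_quantum_isomorphic _ _ (some_vertex _)).
by apply: contraTneq (hs i) => p0; rewrite /p p0 f0 ltxx.
Qed.

End Forward.

Lemma assemble_components (X : cstarAlgType R) (k : nat) (Gs Hs : 'I_k -> graph)
    (s : 'S_k) (v : forall i, Hs (s i) -> Gs i -> X) :
  (forall i, quantum_matrix (@adj (Gs i)) (@adj (Hs (s i))) (v i)) ->
  exists u, quantum_matrix (@sum_adj k Gs) (@sum_adj k Hs) (u : _ -> _ -> X).
Proof.
(* The vertex given to [tagged_as] fixes the type of the result; under the test on tags the value is
   the vertex of [p] itself. *)
move=> vq; pose u (p : {j & Hs j}) (q : {i & Gs i}) : X :=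
  if tag p == s (tag q) then
    v (tag q) (tagged_as (Tagged Hs (some_vertex (Hs (s (tag q))))) p) (tagged q)
  else 0.
have uE i (b : Hs (s i)) (a : Gs i) : u (Tagged Hs b) (Tagged Gs a) = v i b a.
  by rewrite /u /= eqxx tagged_asE.
have u0 i j (b : Hs j) (a : Gs i) : j != s i -> u (Tagged Hs b) (Tagged Gs a) = 0.
  by move=> ij; rewrite /u /= (negPf ij).
have diag j : exists i, j = s i by exists (s^-1%g j); rewrite permKV.
exists u; split.
- move=> [j b] [i a]; have [ji|ji] := eqVneq j (s i).
    by move: b; rewrite ji => b; rewrite uE; exact: qm_proj (vq i) _ _.
  by rewrite u0 //; split; [exact: star0 | exact: mul0r].
- move=> [j b]; have [i ji] := diag j; move: b; rewrite ji => b.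
  rewrite sum_tagged (bigD1 i) //= [X in _ + X]big1 ?addr0 => [|i' ii]; last first.
    by rewrite big1 // => a _; rewrite u0 // (inj_eq perm_inj) eq_sym.
  by under eq_bigr do rewrite uE; exact: qm_row (vq i) b.
- move=> [i a]; rewrite sum_tagged (bigD1 (s i)) //= [X in _ + X]big1 ?addr0 => [|j ji]; last first.
    by rewrite big1 // => b _; rewrite u0.
  by under eq_bigr do rewrite uE; exact: qm_col (vq i) a.
move=> [j b] [i a]; rewrite !sum_tagged.
rewrite (bigD1 i) //= [X in _ + X = _]big1 => [|i' ii]; last first.
  by apply: big_pred0 => x; rewrite /sum_adj /= (negPf ii).
rewrite [in RHS](bigD1 j) //= [X in _ = _ + X]big1 => [|j' jj]; last first.
  by apply: big_pred0 => x; rewrite /sum_adj /= eq_sym (negPf jj).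
rewrite !addr0.
under eq_bigl do rewrite sum_adj_tagged.
under [in RHS]eq_bigl do rewrite sum_adj_tagged.
(* Away from the chosen blocks both sides are sums of zeros. *)
have [ji|ji] := eqVneq j (s i); last by rewrite !big1 // => x _; rewrite u0.
move: b; rewrite ji => b.
under eq_bigr do rewrite uE.
by under [in RHS]eq_bigr do rewrite uE; exact: qm_adj (vq i) b a.
Qed.

End Components.

Theorem theorem3p7 (R : realType) (G H : graph) (k l : nat)
    (Gs : 'I_k -> graph) (Hs : 'I_l -> graph)
    (conn_Gs : forall i, connected_graph (Gs i))
    (conn_Hs : forall j, connected_graph (Hs j))
    (sum_G : is_graph_sum G Gs) (sum_H : is_graph_sum H Hs) :
  quantum_isomorphic R G H <->
  exists (kl : k = l) (s : 'S_k),
    forall i : 'I_k, quantum_isomorphic R (Gs i) (Hs (cast_ord kl (s i))).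
Proof.
have [f bf fE] := sum_G; have [g bg gE] := sum_H; split.
  move=> /quantum_isomorphic_qm [X [u uq]].
  by apply: (matching_components (qm_transfer bf bg fE gE uq)).
case=> kl; subst l => -[s hs].
have [f' fK f'K] := bf; have [g' gK g'K] := bg.
(* A vertex of [G] provides a component; the induction of [common_cstar] starts from one algebra. *)
have k0 : (0 < k)%N.
  by have [i _] := f' (some_vertex G); apply: leq_ltn_trans (ltn_ord i).
have {hs} hs i : exists (Y : cstarAlgType R) (v : Hs (s i) -> Gs i -> Y),
    quantum_matrix (@adj (Gs i)) (@adj (Hs (s i))) v.
  by have := hs i; rewrite cast_ord_id => /quantum_isomorphic_qm.
(* The algebras are fixed first, since [X] depends on all of them at once; [projT2] of the same
   choice later returns the matrix over [Y i]. *)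
pose Y i := projT1 (cid (hs i)).
have [X hX] : exists X : cstarAlgType R, forall i, exists h : Y i -> X, star_hom h.
  by case: (k) k0 (Y) => // n _ Z; exact: common_cstar.
have vX i : exists v : Hs (s i) -> Gs i -> X,
    quantum_matrix (@adj (Gs i)) (@adj (Hs (s i))) v.
  have [h hh] := hX i; have [v vq] := projT2 (cid (hs i)).
  by exists (fun b a => h (v b a)); exact: qm_hom hh vq.
have [u uq] := assemble_components (fun i => projT2 (cid (vX i))).
apply: qm_quantum_isomorphic (qm_transfer _ _ _ _ uq).
- by exists f.
- by exists g.
- by move=> x y; rewrite -fE !f'K.
- by move=> x y; rewrite -gE !g'K.
Qed.
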